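(* Let $F$, $R$, $\Lambda$ be as described in the context (for any admissible choice of parameters). Any continuous function $\phi:R\to\mathbb{R}$ admits an equilibrium state. Moreover, there exists a residual subset of $C^0(\Lambda)$ such that for every potential in this subset the equilibrium state is unique.
   Context: Let $I=[0,1]$, $R=I^3\subset\mathbb{R}^3$, $R_0=I\times I\times[0,1/6]$, $R_1=I\times I\times[5/6,1]$. Fix parameters $0<\lambda_0<1/3$, $\beta_0>6$, $0<\lambda_1<1/3$, $0<\sigma<1/3$, $3<\beta_1<4$. Let $f:I\to I$ be the time-one map of the vector field $x'=x(1-x)$, i.e. $f(y)=\dfrac{y}{y+(1-y)e^{-1}}$; thus $f(0)=0$, $f(1)=1$, $f'(0)=e$, $f'(1)=1/e$. The map $F$ is defined on $R_0\cup R_1$ by $F(x,y,z)=(\lambda_0x,\,f(y),\,\beta_0z)$ if $(x,y,z)\in R_0$, and $F(x,y,z)=(\tfrac34-\lambda_1x,\ \sigma(1-y),\ \beta_1(z-\tfrac56))$ if $(x,y,z)\in R_1$. $F$ is injective on $R_0\cup R_1$. $\Lambda$ is the maximal invariant set of $F$ in the cube: the compact set of points having a full (forward and backward) $F$-orbit contained in $R_0\cup R_1$. $F$ restricts to a homeomorphism of $\Lambda$. $F$-invariant measures are Borel probability measures on $\Lambda$ invariant under $F$. For a continuous potential $\phi$ (on $R$ or on $\Lambda$) and an $F$-invariant probability $\eta$, the $\phi$-pressure of $\eta$ is $h_\eta(F)+\int\phi\,d\eta$, where $h_\eta(F)$ is the metric entropy. $\eta$ is an equilibrium state for $\phi$ if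 its $\phi$-pressure is maximal among the $\phi$-pressures of all $F$-invariant probabilities. $C^0(\Lambda)$ is the Banach space of continuous real functions on $\Lambda$ with the sup norm; a residual set is one containing a countable intersection of open dense sets. *)

(* Defs.v *)
From HB Require Import structures.
From mathcomp Require Import all_boot all_order all_algebra.
From mathcomp Require Import all_classical all_reals all_analysis.

Set Implicit Arguments.
Unset Strict Implicit.
Unset Printing Implicit Defensive.

Import Order.TTheory GRing.Theory Num.Theory.
Import numFieldNormedType.Exports.

Local Open Scope classical_set_scope.
Local Open Scope ring_scope.

Definition residual (T : topologicalType) (A : set T) :=
  exists U : nat -> set T,
    (forall n, open (U n) /\ dense (U n)) /\ \bigcap_n U n `<=` A.

Notation borel T := (g_sigma_algebraType (@open T)).

Definition C0 (T : topologicalType) (R : realType) : Type :=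
  continuousType T R.

Definition C0_fun (T : topologicalType) (R : realType) (phi : C0 T R) :
  arrow_uniform_type T R := (phi : continuousType T R) : T -> R.

(* The topology of uniform convergence, i.e. that of the sup norm when T is
   compact; see [C0_ballE]. *)
HB.instance Definition _ (T : topologicalType) (R : realType) :=
  Choice.copy (C0 T R) (continuousType T R).
HB.instance Definition _ (T : topologicalType) (R : realType) :=
  PseudoMetric.copy (C0 T R) (initial_topology (@C0_fun T R)).

Lemma C0_ballE (T : topologicalType) (R : realType) (phi psi : C0 T R) (e : R) :
  ball phi e psi <-> forall x, `|C0_fun phi x - C0_fun psi x| < e.
Proof. by rewrite -(@initial_ballE _ _ _ (@C0_fun T R)). Qed.

Section entropy.
Context {d : measure_display} {T : measurableType d} {R : realType}.
Variables (eta : probability T R) (g : T -> T).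

Definition invariant_measure :=
  forall A : set T, measurable A -> eta (g @^-1` A) = eta A.

Definition finite_partition (k : nat) (P : 'I_k -> set T) :=
  partition setT P setT /\ forall i, measurable (P i).

(* The atom of P \/ g^-1 P \/ ... \/ g^-(n-1) P with itinerary w. *)
Definition atom (k : nat) (P : 'I_k -> set T) (n : nat)
    (w : {ffun 'I_n -> 'I_k}) : set T :=
  \bigcap_(i in [set: 'I_n]) (iter i g @^-1` P (w i)).

(* The convention 0 * ln 0 = 0 holds as ln is total. *)
Definition join_entropy (k : nat) (P : 'I_k -> set T) (n : nat) : R :=
  - \sum_(w : {ffun 'I_n -> 'I_k})
      fine (eta (atom P w)) * ln (fine (eta (atom P w))).

Definition partition_entropy (k : nat) (P : 'I_k -> set T) : R :=
  limn (fun n => join_entropy P n / n%:R).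

Definition metric_entropy : \bar R :=
  ereal_sup [set h | exists k (P : 'I_k -> set T),
    finite_partition P /\ h = (partition_entropy P)%:E].

Definition pressure (phi : T -> R) : \bar R :=
  (metric_entropy + \int[eta]_x (phi x)%:E)%E.

End entropy.

Record params (R : realType) := Params {
  lambda0 : R; beta0 : R; lambda1 : R; sigma : R; beta1 : R }.

Section horseshoe.
Context {R : realType}.
Variable p : params R.

Definition cube : set (R * R * R) :=
  [set a | [/\ 0 <= a.1.1 <= 1, 0 <= a.1.2 <= 1 & 0 <= a.2 <= 1]].

Definition R0 : set (R * R * R) :=
  [set a | [/\ 0 <= a.1.1 <= 1, 0 <= a.1.2 <= 1 & 0 <= a.2 <= 1 / 6]].

Definition R1 : set (R * R * R) :=
  [set a | [/\ 0 <= a.1.1 <= 1, 0 <= a.1.2 <= 1 & 5 / 6 <= a.2 <= 1]].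

(* The time-one map of y' = y (1 - y) on [0, 1]. *)
Definition flow1 (y : R) : R := y / (y + (1 - y) * expR (- 1)).

(* F is only meaningful on R0 `|` R1; its other values are never used, since
   orbits in [Lambda] stay in R0 `|` R1. *)
Definition Fmap (a : R * R * R) : R * R * R :=
  let: (x, y, z) := a in
  if a \in R0 then (lambda0 p * x, flow1 y, beta0 p * z)
  else (3 / 4 - lambda1 p * x, sigma p * (1 - y), beta1 p * (z - 5 / 6)).

Definition Lambda : set (R * R * R) :=
  [set a | exists orb : int -> R * R * R,
    [/\ orb 0 = a,
        forall n, (R0 `|` R1) (orb n)
      & forall n, Fmap (orb n) = orb (n + 1)]].

Lemma Lambda_stable a : Lambda a -> Lambda (Fmap a).
Proof.
move=> [orb [<- oR oF]]; exists (fun n => orb (n + 1)).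
by split; [rewrite oF | move=> n; exact: oR | move=> n; exact: oF].
Qed.

Lemma Lambda0 : Lambda (0, 0, 0).
Proof.
have R00 : R0 (0, 0, 0) by split; rewrite /= ?lexx ?ler01 ?divr_ge0.
exists (fun=> (0, 0, 0)); split => // _; first by left.
by rewrite /Fmap mem_set // /flow1 !mulr0 mul0r.
Qed.

Definition Lam : Type := set_type Lambda.
HB.instance Definition _ := Choice.copy Lam (set_type Lambda).
HB.instance Definition _ := PseudoMetric.copy Lam (set_type Lambda).
HB.instance Definition _ := isPointed.Build Lam
  (exist _ (0, 0, 0) (mem_set Lambda0) : set_type Lambda).

Definition Lam_val (a : Lam) : R * R * R := set_val (a : set_type Lambda).

Definition FL (a : Lam) : Lam :=
  exist _ (Fmap (Lam_val a)) (mem_set (Lambda_stable (set_valP a))).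

Definition equilibrium_state (phi : Lam -> R) (eta : probability (borel Lam) R) :=
  invariant_measure eta FL /\
  forall eta' : probability (borel Lam) R, invariant_measure eta' FL ->
    (pressure eta' FL phi <= pressure eta FL phi)%E.

(* Measures are compared on Borel sets only: the values of a library measure
   on non-measurable sets are arbitrary. *)
Definition unique_equilibrium_state (phi : Lam -> R) :=
  exists eta : probability (borel Lam) R, equilibrium_state phi eta /\
    forall eta' : probability (borel Lam) R, equilibrium_state phi eta' ->
      forall A : set (borel Lam), measurable A -> eta' A = eta A.

End horseshoe.

(* Main.v *)
(* Code an orbit by its visits to R0 and R1, and let P be the corresponding
   clopen partition of Lambda. Along a fixed P-itinerary every iterate of F is
   monotone in each of the three coordinates, so a partition of the cube into
   finitely many boxes has, inside a P-cylinder of length n, only polynomially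
   many itineraries. Boxes generate the Borel sets, hence h(F) = h(F, P) for
   every invariant measure. As P is clopen, this makes the entropy bounded and
   upper semicontinuous, and an ultrafilter limit of a maximizing sequence,
   obtained from a Riesz representation on the compact set Lambda, is an
   equilibrium state.

   The top pressure is 1-Lipschitz in the potential phi, and every integral
   against an equilibrium state is a slope of it at phi. So if for each psi in a
   countable family determining measures, and each eps > 0, some symmetric second
   difference of the pressure in direction psi is < eps t, the equilibrium state
   is unique. Each of these conditions is open and dense. *)
From HB Require Import structures.
Require Import Defs.
From mathcomp Require Import all_boot all_order all_algebra.
From mathcomp Require Import all_classical all_reals all_analysis.
From mathcomp Require Import measurable_realfun ring lra.

Set Implicit Arguments.
Unset Strict Implicit.
Unset Printing Implicit Defensive.

Import Order.TTheory GRing.Theory Num.Theory.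
Import numFieldNormedType.Exports.

Local Open Scope classical_set_scope.
Local Open Scope ring_scope.

(** * Entropy of finite labels *)

(** The obstacle is that F is not expansive. The segment {0} x [0,1] x {0} lies in Lambda, F acts on
    it by [flow1], and all its points have the same itinerary, so the visits to R0 and R1 do not
    separate points and P is not a generator in the topological sense. Counting takes the place of
    separation. Once orientation reversals are corrected, the list of levels of one coordinate along
    a P-cylinder of length n is monotone in the initial point. The lists that occur thus form a
    chain in {0,...,m}^n, which has at most n m + 1 elements, and the logarithm of this number is
    o(n).

    An ultrafilter makes the means of all continuous functions converge at once, so the limit is
    directly a positive linear functional, with no diagonal extraction. For genericity, asking for
    one t > 0 instead of a derivative turns differentiability into a strict inequality between three
    values of the pressure. *)

Section finite_entropy.
Context {d : measure_display} {T : measurableType d} {R : realType}.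
Variable eta : probability T R.

(** Partitions are encoded as labellings: a join is a pair of labels, a coarser partition is a
    composition, and empty atoms are harmless. *)
Definition measurable_label (I : Type) (c : T -> I) :=
  forall i, measurable (c @^-1` [set i]).

Definition mass (I : Type) (c : T -> I) (i : I) : R :=
  fine (eta (c @^-1` [set i])).

Definition entropy (I : finType) (c : T -> I) : R :=
  - \sum_i mass c i * ln (mass c i).

Lemma mass_ge0 (I : Type) (c : T -> I) i : 0 <= mass c i.
Proof. exact: fine_ge0. Qed.

Lemma measurable_label_comp (I J : finType) (c : T -> I) (f : I -> J) :
  measurable_label c -> measurable_label (f \o c).
Proof.
move=> mc j.
rewrite (_ : _ @^-1` _ = \bigcup_(i in [set i | f i = j]) (c @^-1` [set i])).
  by apply: fin_bigcup_measurable => // i _; exact: mc.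
by apply/seteqP; split=> [x /= fj|x [i /= <- ->]//]; exists (c x).
Qed.

(** Lets refinement of partitions be stated pointwise, as an implication between equalities of
    labels. Off the range of [e], the factor takes the default value [c point]. *)
Lemma label_factor (I J : Type) (c : T -> I) (e : T -> J) :
  (forall x y, e x = e y -> c x = c y) -> exists f, c = f \o e.
Proof.
move=> ec; exists (fun j => c (xget point [set x | e x = j])).
apply/funext => x; apply: ec.
by rewrite (@xgetPex _ point [set y | e y = e x])//; exists x.
Qed.

Lemma measurable_label_factor (I J : finType) (c : T -> I) (e : T -> J) :
  measurable_label e -> (forall x y, e x = e y -> c x = c y) ->
  measurable_label c.
Proof. by move=> me /label_factor[f ->]; exact: measurable_label_comp. Qed.

Lemma measurable_label_pair (I J : Type) (c : T -> I) (e : T -> J) :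
  measurable_label c -> measurable_label e ->
  measurable_label (fun x => (c x, e x)).
Proof.
move=> mc me [i j]; rewrite (_ : _ @^-1` _ = c @^-1` [set i] `&` e @^-1` [set j]).
  exact: measurableI.
by apply/seteqP; split=> x /= [-> ->].
Qed.

Lemma mass_comp (I J : finType) (c : T -> I) (f : I -> J) j :
  measurable_label c -> mass (f \o c) j = \sum_(i | f i == j) mass c i.
Proof.
move=> mc; rewrite /mass.
rewrite (_ : _ @^-1` _ = \bigcup_(i in [set` enum [pred i | f i == j]])
    (c @^-1` [set i])); last first.
  apply/seteqP; split=> [x /= fj|x [i /=]].
    by exists (c x) => //=; rewrite mem_enum inE fj.
  by rewrite mem_enum inE => /eqP <- ->.
rewrite measure_fin_bigcup//; last by move=> i k _ _ [x [/= -> ->]].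
rewrite -fsbig_seq ?enum_uniq// big_enum/= -sum_fine// => i _.
by rewrite fin_num_measure.
Qed.

Lemma mass_le_comp (I J : finType) (c : T -> I) (f : I -> J) i :
  measurable_label c -> mass c i <= mass (f \o c) (f i).
Proof.
move=> mc; rewrite mass_comp// (bigD1 i)//= lerDl.
by apply: sumr_ge0 => k _; exact: mass_ge0.
Qed.

Lemma sum_mass_comp (I J : finType) (c : T -> I) (f : I -> J) (G : J -> R) :
  measurable_label c ->
  \sum_i mass c i * G (f i) = \sum_j mass (f \o c) j * G j.
Proof.
move=> mc; rewrite (partition_big f predT)//=; apply: eq_bigr => j _.
by rewrite mass_comp// mulr_suml; apply: eq_bigr => i /eqP ->.
Qed.

Lemma sum_mass (I : finType) (c : T -> I) :
  measurable_label c -> \sum_i mass c i = 1.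
Proof.
move=> mc; rewrite -(@mass_comp _ unit c (fun=> tt) tt mc) /mass.
by rewrite (_ : _ @^-1` _ = setT) ?probability_setT//; apply/seteqP; split.
Qed.

Lemma entropyE (I J : finType) (c : T -> I) (f : I -> J) :
  measurable_label c ->
  entropy (f \o c) = - \sum_i mass c i * ln (mass (f \o c) (f i)).
Proof. by move=> mc; rewrite /entropy -sum_mass_comp. Qed.

Lemma entropy_ge0 (I : finType) (c : T -> I) :
  measurable_label c -> 0 <= entropy c.
Proof.
move=> mc; rewrite /entropy -sumrN sumr_ge0// => i _.
rewrite oppr_ge0 mulr_ge0_le0 ?mass_ge0// ln_le0//.
rewrite -(sum_mass mc) (bigD1 i)//= lerDl.
by apply: sumr_ge0 => k _; exact: mass_ge0.
Qed.

Lemma ln_le_sub1 (x : R) : 0 < x -> ln x <= x - 1.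
Proof.
by move=> x0; rewrite -{1}(subrKC 1 x) le_ln1Dx// ltrBrDl subrr.
Qed.

(** Sum of p ln (q / p) <= q - p, which is [ln_le_sub1] at q / p; terms with p = 0 are bounded
    separately. *)
Lemma gibbs (I : finType) (p q : I -> R) :
  (forall i, 0 <= p i) -> (forall i, 0 <= q i) ->
  (forall i, 0 < p i -> 0 < q i) ->
  \sum_i q i <= \sum_i p i ->
  - \sum_i p i * ln (p i) <= - \sum_i p i * ln (q i).
Proof.
move=> p0 q0 pq0 pq; rewrite lerN2 -subr_ge0 -sumrB.
apply: (@le_trans _ _ (\sum_i (p i - q i))); first by rewrite sumrB subr_ge0.
apply: ler_sum => i _; rewrite -mulrBr.
have := p0 i; rewrite le_eqVlt => /predU1P[<-|pi0].
  by rewrite mul0r sub0r oppr_le0.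
have qi0 := pq0 _ pi0.
have := ln_le_sub1 (divr_gt0 qi0 pi0); rewrite ln_div ?posrE// => /(ler_wpM2l (p0 i)).
by rewrite !mulrBr mulrCA divff ?gt_eqF// !mulr1; lra.
Qed.

Lemma entropy_comp_le (I J : finType) (c : T -> I) (f : I -> J) :
  measurable_label c -> entropy (f \o c) <= entropy c.
Proof.
move=> mc; rewrite entropyE// lerN2; apply: ler_sum => i _.
have := mass_ge0 c i; rewrite le_eqVlt => /predU1P[<-|ci0]; first by rewrite !mul0r.
have le := mass_le_comp f i mc.
by rewrite ler_pM2l// ler_ln ?posrE// (lt_le_trans ci0).
Qed.

Lemma entropy_le (I J : finType) (c : T -> I) (e : T -> J) :
  measurable_label e -> (forall x y, e x = e y -> c x = c y) ->
  entropy c <= entropy e.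
Proof. by move=> me /label_factor[f ->]; exact: entropy_comp_le. Qed.

Lemma entropy_le_card (I : finType) (c : T -> I) :
  measurable_label c -> entropy c <= ln #|I|%:R.
Proof.
move=> mc; have I0 : (0 < #|I|)%N by apply/card_gt0P; exists (c point).
have I0' : 0 < #|I|%:R :> R by rewrite ltr0n.
apply: le_trans (@gibbs _ (mass c) (fun=> #|I|%:R^-1) _ _ _ _) _ => //.
- by move=> i; exact: mass_ge0.
- by move=> i _ /=; rewrite invr_gt0.
- by rewrite sumr_const -[leLHS]mulr_natr mulVf ?gt_eqF// sum_mass.
- by rewrite -mulr_suml sum_mass// mul1r lnV ?posrE// opprK.
Qed.

(* The weights m(i,j) m(j,k) / m(j) have total mass at most 1; compare them
   with m(i,j,k) by Gibbs' inequality. *)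
Lemma entropy_ssa (I J K : finType) (a : T -> I) (b : T -> J) (c : T -> K) :
  measurable_label a -> measurable_label b -> measurable_label c ->
  entropy (fun x => (a x, b x, c x)) + entropy b <=
  entropy (fun x => (a x, b x)) + entropy (fun x => (b x, c x)).
Proof.
move=> ma mb mc.
(* All labels involved are projections of [z], so by [entropyE] the four entropies become sums over
   one index set with the common weights [p]. *)
pose z x := (a x, b x, c x).
have mz : measurable_label z by apply: measurable_label_pair => //; exact: measurable_label_pair.
pose fab (v : I * J * K) := v.1.
pose fbc (v : I * J * K) := (v.1.2, v.2).
pose fb (v : I * J * K) := v.1.2.
pose p := mass z.
pose q v := mass (fab \o z) (fab v) * mass (fbc \o z) (fbc v) / mass (fb \o z) (fb v).
have pab v : 0 < p v -> 0 < mass (fab \o z) (fab v).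
  by move=> pv; exact: lt_le_trans (mass_le_comp _ _ mz).
have pbc v : 0 < p v -> 0 < mass (fbc \o z) (fbc v).
  by move=> pv; exact: lt_le_trans (mass_le_comp _ _ mz).
have pb v : 0 < p v -> 0 < mass (fb \o z) (fb v).
  by move=> pv; exact: lt_le_trans (mass_le_comp _ _ mz).
have : entropy z <= - \sum_v p v * ln (q v).
  apply: gibbs => [v|v|v pv|]; first exact: mass_ge0.
  - by rewrite divr_ge0 ?mulr_ge0 ?mass_ge0.
  - by rewrite divr_gt0 ?mulr_gt0 ?pab ?pbc ?pb.
  have mab : measurable_label (fab \o z) by exact: measurable_label_comp.
  have mbc : measurable_label (fbc \o z) by exact: measurable_label_comp.
  rewrite sum_mass//.
  have -> : \sum_v q v = \sum_j (\sum_i mass (fab \o z) (i, j)) *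
      (\sum_k mass (fbc \o z) (j, k)) / mass (fb \o z) j.
    under [RHS]eq_bigr do rewrite mulr_suml mulr_suml.
    rewrite exchange_big/= pair_bigA/=.
    under [RHS]eq_bigr do rewrite mulr_sumr mulr_suml.
    by rewrite pair_bigA/=; apply: eq_bigr => -[[i j] k] _.
  rewrite -[leRHS](@sum_mass J b)//; apply: ler_sum => j _.
  have -> : \sum_i mass (fab \o z) (i, j) = mass b j.
    rewrite -[b]/(snd \o (fab \o z)) mass_comp//.
    rewrite (reindex_onto (fun i => (i, j)) fst) => [|[i k]/= /eqP -> //].
    by apply: eq_bigl => i /=; rewrite !eqxx.
  have -> : \sum_k mass (fbc \o z) (j, k) = mass b j.
    rewrite -[b]/(fst \o (fbc \o z)) mass_comp//.
    rewrite (reindex_onto (fun k => (j, k)) snd) => [|[i k]/= /eqP -> //].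
    by apply: eq_bigl => i /=; rewrite !eqxx.
  rewrite -[fb \o z]/b.
  (* When [mass eta b j] is 0 the quotient is 0 as well, because the numerator vanishes. *)
  have := mass_ge0 b j; rewrite le_eqVlt => /predU1P[<-|b0].
    by rewrite !mul0r.
  by rewrite mulfK// gt_eqF.
rewrite -[fun x => (a x, b x)]/(fab \o z) -[fun x => (b x, c x)]/(fbc \o z).
rewrite -[entropy b]/(entropy (fb \o z)) !entropyE// -/z -/p.
suff -> : \sum_v p v * ln (q v) = \sum_v p v * ln (mass (fab \o z) (fab v)) +
  \sum_v p v * ln (mass (fbc \o z) (fbc v)) - \sum_v p v * ln (mass (fb \o z) (fb v)).
  by lra.
rewrite -big_split/= -sumrB; apply: eq_bigr => v _.
have := mass_ge0 z v; rewrite le_eqVlt => /predU1P[pv|pv].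
  by rewrite /p -pv !mul0r addr0 subr0.
rewrite /q ln_div ?lnM ?posrE ?pab ?pbc ?pb//; last by rewrite mulr_gt0 ?pab ?pbc.
by rewrite mulrBr mulrDr.
Qed.

End finite_entropy.

(** * Conditional entropy *)

Section conditional_entropy.
Context {d : measure_display} {T : measurableType d} {R : realType}.
Variable eta : probability T R.

Definition cond_entropy (I J : finType) (a : T -> I) (b : T -> J) : R :=
  entropy eta (fun x => (a x, b x)) - entropy eta b.

(** By the chain rule H(a,b|u,v) = H(a|u,b,v) + H(b|u,v); strong subadditivity removes (b,v) from
    the first condition ([h1]) and u from the second ([h2]). The other inequalities only reorder
    tuples. *)
Lemma cond_entropy_pair (I1 I2 J1 J2 : finType)
    (a : T -> I1) (b : T -> I2) (u : T -> J1) (v : T -> J2) :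
  measurable_label a -> measurable_label b ->
  measurable_label u -> measurable_label v ->
  cond_entropy (fun x => (a x, b x)) (fun x => (u x, v x)) <=
  cond_entropy a u + cond_entropy b v.
Proof.
move=> ma mb mu mv; rewrite /cond_entropy.
have mbv := measurable_label_pair mb mv.
have muv := measurable_label_pair mu mv.
have h1 := entropy_ssa eta ma mu mbv.
have h2 := entropy_ssa eta mu mv mb.
have h3 : entropy eta (fun x => (a x, b x, (u x, v x))) <=
    entropy eta (fun x => (a x, u x, (b x, v x))).
  apply: entropy_le; last by move=> x y [-> -> -> ->].
  by apply: measurable_label_pair => //; exact: measurable_label_pair.
have h4 : entropy eta (fun x => (u x, (b x, v x))) <=
    entropy eta (fun x => (u x, v x, b x)).
  apply: entropy_le; last by move=> x y [-> -> ->].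
  exact: measurable_label_pair.
have h5 : entropy eta (fun x => (v x, b x)) <= entropy eta (fun x => (b x, v x)).
  by apply: entropy_le => // x y [-> ->].
lra.
Qed.

(** Both conditions in [cond_entropy_pair] are taken to be a one-valued label, whose entropy is
    0. *)
Lemma entropy_subadd (I J : finType) (a : T -> I) (b : T -> J) :
  measurable_label a -> measurable_label b ->
  entropy eta (fun x => (a x, b x)) <= entropy eta a + entropy eta b.
Proof.
move=> ma mb; pose tt' (x : T) := tt.
have mt : measurable_label tt'.
  by move=> []; rewrite (_ : _ @^-1` _ = setT)//; apply/seteqP; split.
have := cond_entropy_pair ma mb mt mt; rewrite /cond_entropy.
have t0 : entropy eta tt' = 0.
  apply/eqP; rewrite eq_le entropy_ge0// andbT.
  by apply: le_trans (entropy_le_card eta mt) _; rewrite card_unit ln1.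
have tt0 : entropy eta (fun x => (tt' x, tt' x)) <= 0.
  by rewrite -t0; apply: entropy_le.
have ha : entropy eta (fun x => (a x, tt' x)) <= entropy eta a.
  by apply: entropy_le => // x y ->.
have hb : entropy eta (fun x => (b x, tt' x)) <= entropy eta b.
  by apply: entropy_le => // x y ->.
have hab : entropy eta (fun x => (a x, b x)) <=
    entropy eta (fun x => (a x, b x, (tt' x, tt' x))).
  apply: entropy_le => [|x y [-> ->]//].
  by apply: measurable_label_pair; exact: measurable_label_pair.
lra.
Qed.

(* Each term m(i,j) ln (m(j) / m(i,j)) is at most m(j) - m(i,j) and at most
   delta m(j) + m(i,j) ln (1 / delta); use the former when [S i j]. *)
Lemma cond_entropy_small (I J : finType) (c : T -> I) (e : T -> J)
    (S : I -> J -> bool) (eps delta : R) :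
  measurable_label c -> measurable_label e -> 0 < delta <= 1 ->
  (forall i, mass eta (fun x => (c x == i) (+) S i (e x)) true <= eps) ->
  cond_entropy c e <= #|I|%:R * (delta + eps * (1 - ln delta)).
Proof.
move=> mc me /andP[delta0 delta1] heps.
have lnd : ln delta <= 0 by exact: ln_le0.
pose z x := (c x, e x).
have mz : measurable_label z by exact: measurable_label_pair.
pose p i j := mass eta z (i, j).
have pge0 i j : 0 <= p i j by exact: mass_ge0.
have pe j : mass eta e j = \sum_i p i j.
  rewrite -[e]/(snd \o z) mass_comp//.
  rewrite (reindex_onto (fun i => (i, j)) fst) => [|[i k]/= /eqP -> //].
  by apply: eq_bigl => i /=; rewrite !eqxx.
have -> : cond_entropy c e =
    \sum_i \sum_j p i j * (ln (mass eta e j) - ln (p i j)).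
  rewrite /cond_entropy -[X in _ - entropy _ X]/(snd \o z) entropyE// /entropy -/z.
  rewrite pair_bigA/= opprK addrC -sumrB; apply: eq_bigr => -[i j] _ /=.
  by rewrite mulrBr.
rewrite mulr_natl -sumr_const.
apply: ler_sum => i _.
(* Spreading [delta] over the atoms of [e] reduces the estimate to one inequality for each j. *)
have de : delta = \sum_j delta * mass eta e j.
  by rewrite -mulr_sumr sum_mass// mulr1.
rewrite [X in X + _]de.
have xor_eps : \sum_j \sum_(k | (k == i) (+) S i j) p k j <= eps.
  apply: le_trans (heps i).
  rewrite -[X in mass _ X]/((fun v => (v.1 == i) (+) S i v.2) \o z).
  rewrite mass_comp// [leRHS]big_mkcond/=.
  under eq_bigr do rewrite big_mkcond/=.
  rewrite exchange_big/= pair_bigA/= le_eqVlt; apply/orP; left; apply/eqP.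
  by apply: eq_bigr => -[k j] _ /=; rewrite eqb_id.
have {}xor_eps : \sum_j (\sum_(k | (k == i) (+) S i j) p k j) * (1 - ln delta) <=
    eps * (1 - ln delta).
  by rewrite -mulr_suml ler_wpM2r// subr_ge0; lra.
move: xor_eps; rewrite -(lerD2l (\sum_j delta * mass eta e j)); apply: le_trans.
rewrite -big_split/=; apply: ler_sum => j _.
have s0 : 0 <= \sum_(k | (k == i) (+) S i j) p k j by exact: sumr_ge0.
have ej0 := mass_ge0 eta e j.
have := pge0 i j; rewrite le_eqVlt => /predU1P[<-|pij].
  by rewrite mul0r; apply: addr_ge0; apply: mulr_ge0 => //; lra.
have pij_le : p i j <= mass eta e j by rewrite pe (bigD1 i)//= lerDl sumr_ge0.
have ej : 0 < mass eta e j by lra.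
(* Inside atom j, the error set of i consists of all labels k != i if [S i j] holds, and of k = i
   alone otherwise. In each case the bound chosen charges only the mass of that error set and
   [delta * mass eta e j]. *)
case: (boolP (S i j)) => Sij.
  apply: (@le_trans _ _ (\sum_(k | k != i) p k j)).
    have -> : \sum_(k | k != i) p k j = mass eta e j - p i j.
      by rewrite pe [in RHS](bigD1 i)//= addrC addrK.
    rewrite -ln_div ?posrE//.
    have := ln_le_sub1 (divr_gt0 ej pij) => /(ler_wpM2l (pge0 i j)).
    by rewrite mulrBr mulrCA divff ?gt_eqF// !mulr1.
  rewrite [X in _ + X * _](eq_bigl (fun k => k != i)); last by move=> k; rewrite addbT.
  have : 0 <= \sum_(k | k != i) p k j by exact: sumr_ge0.
  set s := \sum_(k | _) _ => s0'.
  have : 0 <= delta * mass eta e j by rewrite mulr_ge0 ?ltW.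
  have : 0 <= s * - ln delta by rewrite mulr_ge0// oppr_ge0.
  lra.
rewrite [X in _ + X * _](eq_bigl (fun k => k == i)); last by move=> k; rewrite addbF.
rewrite big_pred1_eq.
have := ln_le_sub1 (divr_gt0 (mulr_gt0 delta0 ej) pij) => /(ler_wpM2l (pge0 i j)).
rewrite ln_div ?posrE ?mulr_gt0// lnM ?posrE//.
rewrite !mulrBr mulrCA divff ?gt_eqF// !mulr1; lra.
Qed.

End conditional_entropy.

(** * Itineraries and entropy rates *)

Section fekete.
Context {R : realType}.
Variable a : nat -> R.
Hypothesis a_ge0 : forall n, 0 <= a n.
Hypothesis a_subadd : forall n m, a (n + m)%N <= a n + a m.

Lemma subadditive_mul (k n : nat) : a (k * n)%N <= k%:R * a n + a 0.
Proof.
elim: k => [|k IH]; first by rewrite mul0n mul0r add0r.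
rewrite mulSn (le_trans (a_subadd _ _))// -natr1; lra.
Qed.

(** Euclidean division of n by a nearly optimal m shows that the limit is the infimum of the
    ratios. *)
Lemma fekete : exists l, (fun n => a n / n%:R) @ \oo --> l /\
  forall n, (0 < n)%N -> l <= a n / n%:R.
Proof.
pose A := [set a n / n%:R | n in [set n | (0 < n)%N]].
have lbA : lbound A 0 by move=> _ [n _ <-]; rewrite divr_ge0.
have infA : has_inf A by split; [exists (a 1%N / 1); exists 1%N|exists 0].
have lA n : (0 < n)%N -> inf A <= a n / n%:R.
  by move=> n0; apply: ge_inf; [exists 0|exists n].
exists (inf A); split => //.
apply/cvgrPdist_le => e e0.
have [_ [m m0 <-] am] := inf_adherent (divr_gt0 e0 (ltr0n R 2)) infA.
have m0R : 0 < m%:R :> R by rewrite ltr0n.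
(* [M] absorbs the term [a 0] left by [subadditive_mul] and the value of [a] at any remainder modulo
   m. *)
pose M := a 0 + \sum_(i < m) a i.
have M0 : 0 <= M by rewrite addr_ge0// sumr_ge0.
near=> n.
have n0 : (0 < n)%N by near: n; exists 1%N.
have n0R : 0 < n%:R :> R by rewrite ltr0n.
rewrite distrC ger0_norm ?subr_ge0 ?lA//.
have Mn : M / n%:R <= e / 2.
  rewrite ler_pdivrMr// mulrC -ler_pdivrMr ?divr_gt0//.
  by near: n; exact: nbhs_infty_ger.
suff : a n / n%:R <= a m / m%:R + M / n%:R by lra.
rewrite ler_pdivrMr// mulrDl mulfVK ?gt_eqF//.
rewrite {1}(divn_eq n m) (le_trans (a_subadd _ _))//.
have := subadditive_mul (n %/ m) m.
have : a (n %% m)%N <= \sum_(i < m) a i.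
  rewrite (bigD1 (Ordinal (ltn_pmod n m0)))//= lerDl.
  by apply: sumr_ge0.
have : (n %/ m)%:R * a m <= a m / m%:R * n%:R.
  rewrite -mulrA [leLHS]mulrC ler_wpM2l// ler_pdivlMl// mulrC -natrM ler_nat.
  by rewrite leq_trunc_div.
by rewrite /M; lra.
Unshelve. all: by end_near. Qed.

End fekete.

Definition itinerary (T : Type) (g : T -> T) (I : finType) (c : T -> I)
    (n : nat) (x : T) : {ffun 'I_n -> I} :=
  [ffun i : 'I_n => c (iter i g x)].

Section itineraries.
Context {d : measure_display} {T : measurableType d} {R : realType}.
Variables (eta : probability T R) (g : T -> T).
Hypothesis mg : forall A, measurable A -> measurable (g @^-1` A).
Hypothesis invg : invariant_measure eta g.

Lemma measurable_preimage_iter k A :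
  measurable A -> measurable (iter k g @^-1` A).
Proof.
by elim: k A => [//|k IH] A mA; exact: (IH _ (mg mA)).
Qed.

Lemma measurable_label_iter (I : Type) (c : T -> I) k :
  measurable_label c -> measurable_label (c \o iter k g).
Proof. by move=> mc i; exact: (measurable_preimage_iter k (mc i)). Qed.

Lemma measure_preimage_iter k A :
  measurable A -> eta (iter k g @^-1` A) = eta A.
Proof.
elim: k A => [//|k IH] A mA.
by rewrite -[RHS]invg//; exact: (IH _ (mg mA)).
Qed.

Lemma entropy_iter (I : finType) (c : T -> I) k :
  measurable_label c -> entropy eta (c \o iter k g) = entropy eta c.
Proof.
move=> mc; rewrite /entropy; congr (- _); apply: eq_bigr => i _.
suff -> : mass eta (c \o iter k g) i = mass eta c i by [].
exact: congr1 (measure_preimage_iter k (mc i)).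
Qed.

Lemma measurable_itinerary (I : finType) (c : T -> I) n :
  measurable_label c -> measurable_label (itinerary g c n).
Proof.
move=> mc w; rewrite (_ : _ @^-1` _ =
    \bigcap_(i in [set: 'I_n]) (c \o iter i g) @^-1` [set w i]).
  by apply: fin_bigcap_measurable => // i _; exact: measurable_label_iter.
apply/seteqP; split=> [x /= <- i _ /=|x /= xw]; first by rewrite ffunE.
by apply/ffunP => i; rewrite ffunE; exact: xw.
Qed.

Lemma itineraryDP (I : finType) (c : T -> I) n m x y :
  itinerary g c n x = itinerary g c n y ->
  itinerary g c m (iter n g x) = itinerary g c m (iter n g y) ->
  itinerary g c (n + m)%N x = itinerary g c (n + m)%N y.
Proof.
move=> /ffunP e1 /ffunP e2; apply/ffunP => i; rewrite !ffunE.
have [ni|ni] := ltnP i n.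
  by have := e1 (Ordinal ni); rewrite !ffunE.
have nim : (i - n < m)%N by rewrite ltn_subLR.
have := e2 (Ordinal nim); rewrite !ffunE /=.
by rewrite -!iterD subnK.
Qed.

Lemma entropy_itinerary_subadd (I : finType) (c : T -> I) n m :
  measurable_label c ->
  entropy eta (itinerary g c (n + m)%N) <=
  entropy eta (itinerary g c n) + entropy eta (itinerary g c m).
Proof.
move=> mc; rewrite -(entropy_iter n (@measurable_itinerary _ _ m mc)).
have m1 := @measurable_itinerary _ _ n mc.
have m2 := measurable_label_iter n (@measurable_itinerary _ _ m mc).
apply: le_trans (entropy_subadd eta m1 m2).
apply: entropy_le; first exact: measurable_label_pair.
by move=> x y [e1 e2]; exact: itineraryDP.
Qed.

Lemma entropy_itinerary_cvg (I : finType) (c : T -> I) :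
  measurable_label c ->
  exists l, (fun n => entropy eta (itinerary g c n) / n%:R) @ \oo --> l /\
    forall n, (0 < n)%N -> l <= entropy eta (itinerary g c n) / n%:R.
Proof.
move=> mc; apply: (@fekete _ (fun n => entropy eta (itinerary g c n))).
  by move=> n; apply: entropy_ge0; exact: measurable_itinerary.
by move=> n m; exact: entropy_itinerary_subadd.
Qed.

(** By [cond_entropy_pair], each new time step adds at most the conditional entropy of
    [c \o iter n g] given [e \o iter n g], and invariance makes this H(c|e). *)
Lemma entropy_itinerary_cond (I J : finType) (c : T -> I) (e : T -> J) n :
  measurable_label c -> measurable_label e ->
  cond_entropy eta (itinerary g c n) (itinerary g e n) <= n%:R * cond_entropy eta c e.
Proof.
move=> mc me; elim: n => [|n IH].
  rewrite mul0r subr_le0; apply: entropy_le; first exact: measurable_itinerary.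
  by move=> x y exy; congr pair => //; apply/ffunP => -[].
have mcn := @measurable_itinerary _ _ n mc; have men := @measurable_itinerary _ _ n me.
have mc' := measurable_label_iter n mc; have me' := measurable_label_iter n me.
have := cond_entropy_pair eta mcn mc' men me'.
have -> : cond_entropy eta (c \o iter n g) (e \o iter n g) = cond_entropy eta c e.
  rewrite /cond_entropy (entropy_iter n me); congr (_ - _).
  exact: (entropy_iter n (measurable_label_pair mc me)).
have itS (K : finType) (b : T -> K) x y : (itinerary g b n.+1 x = itinerary g b n.+1 y) <->
    (itinerary g b n x = itinerary g b n y /\ b (iter n g x) = b (iter n g y)).
  split=> [/ffunP bxy|[/ffunP b1 b2]].
    split; last by have := bxy ord_max; rewrite !ffunE.
    apply/ffunP => i; have := bxy (widen_ord (leqnSn n) i).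
    by rewrite !ffunE.
  apply/ffunP => i; rewrite !ffunE; have [ni|ni] := ltnP i n.
    by have := b1 (Ordinal ni); rewrite !ffunE.
  by have -> : nat_of_ord i = n by apply/eqP; rewrite eqn_leq ni -ltnS ltn_ord.
rewrite /cond_entropy.
have h1 : entropy eta (fun x => (itinerary g c n.+1 x, itinerary g e n.+1 x)) <=
    entropy eta (fun x => ((itinerary g c n x, (c \o iter n g) x),
                           (itinerary g e n x, (e \o iter n g) x))).
  apply: entropy_le; first by apply: measurable_label_pair; exact: measurable_label_pair.
  by move=> x y [c1 c2 e1 e2]; congr pair; apply/itS.
have h2 : entropy eta (fun x => (itinerary g e n x, (e \o iter n g) x)) <=
    entropy eta (itinerary g e n.+1).
  apply: entropy_le; first exact: measurable_itinerary.
  by move=> x y /itS[e1 e2]; congr pair.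
move: IH; rewrite /cond_entropy -natr1 mulrDl mul1r; lra.
Qed.

Lemma join_entropyE (k : nat) (P : 'I_k -> set T) (c : T -> 'I_k) n :
  (forall i x, P i x <-> c x = i) ->
  join_entropy eta g P n = entropy eta (itinerary g c n).
Proof.
move=> Pc; rewrite /join_entropy /entropy; congr (- _); apply: eq_bigr => w _.
rewrite /mass (_ : atom g P w = itinerary g c n @^-1` [set w])//.
apply/seteqP; split=> [x xw|x /= <- i _ /=].
  by apply/ffunP => i; rewrite ffunE; apply/Pc; exact: xw.
by apply/Pc; rewrite ffunE.
Qed.

Lemma partition_label (k : nat) (P : 'I_k -> set T) :
  finite_partition P ->
  exists2 c : T -> 'I_k, measurable_label c & forall i x, P i x <-> c x = i.
Proof.
move=> [[cP tP _] mP].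
have /choice[c cE] : forall x, exists i, P i x.
  move=> x; have : setT x by [].
  by rewrite -cP => -[i _ Pix]; exists i.
have Pc i x : P i x <-> c x = i.
  split=> [Pix|<-]; last exact: cE.
  by apply: tP => //; exists x; split.
exists c => // i; rewrite (_ : _ @^-1` _ = P i)//.
by apply/seteqP; split=> x /Pc.
Qed.

End itineraries.

(** * Coding by a monotone partition *)

Section monotone_coding.
Context {T : Type} {R : realType} {I : finType}.
Variables (g : T -> T) (P : T -> I) (r : nat -> R) (u : T -> R) (o : I -> bool).
Hypothesis mono : forall x y, P x = P y -> u x <= u y ->
  if o (P x) then u (g y) <= u (g x) else u (g x) <= u (g y).

(** The rank of [u x] among the first m thresholds. Counting makes it monotone in [u x] although the
    thresholds are not sorted. *)
Definition level (m : nat) (x : T) : nat := \sum_(i < m) (r i < u x)%R.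

Lemma level_le m x : (level m x <= m)%N.
Proof.
rewrite /level -[leqRHS](card_ord m) -sum1_card; apply: leq_sum => i _.
exact: leq_b1.
Qed.

Lemma le_level m x y : u x <= u y -> (level m x <= level m y)%N.
Proof.
move=> xy; apply: leq_sum => i _; have [rx|//] := ltP (r i) (u x).
by rewrite (lt_le_trans rx xy).
Qed.

Lemma sum_nat_eq (n : nat) (f h : 'I_n -> nat) : (forall i, f i <= h i)%N ->
  (\sum_i f i = \sum_i h i)%N -> forall i, f i = h i.
Proof.
move=> fh fhE i; apply/eqP; rewrite eqn_leq fh/= -subn_eq0.
have : (\sum_i (h i - f i) == 0)%N.
  by rewrite sumnB// fhE subnn.
by rewrite sum_nat_eq0 => /forallP/(_ i).
Qed.

(** All comparisons with thresholds move in the same direction as [u], so equal counts force each of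
    them to agree. *)
Lemma level_inj m x y i : (i < m)%N -> level m x = level m y ->
  (r i < u x) = (r i < u y).
Proof.
move=> im; wlog xy : x y / u x <= u y => [H|] e.
  by have [/H|/ltW/H] := leP (u x) (u y); [exact|move=> H'; rewrite H'].
have fh (j : 'I_m) : ((r j < u x)%R <= (r j < u y)%R)%N.
  by have [rx|//] := ltP (r j) (u x); rewrite (lt_le_trans rx xy).
by have := sum_nat_eq fh e (Ordinal im) => /=; do 2 case: (_ < _).
Qed.

Definition reversed (j : nat) (x : T) : bool :=
  odd (\sum_(k < j) o (P (iter k g x))).

(** Complementing in m undoes a reversal of orientation. The subtraction never truncates, by
    [level_le], so the level can be recovered from its complement. *)
Definition code_term (m j : nat) (x : T) : nat :=
  if reversed j x then (m - level m (iter j g x))%N else level m (iter j g x).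

(* Along a fixed P-itinerary every summand is nondecreasing in u, so the sum
   determines each summand. *)
Definition code (m n : nat) (x : T) : nat := \sum_(j < n) code_term m j x.

Lemma code_le m n x : (code m n x <= n * m)%N.
Proof.
rewrite /code -[X in (X * m)%N](card_ord n) -sum_nat_const; apply: leq_sum => j _.
by rewrite /code_term; case: ifP => _; [exact: leq_subr|exact: level_le].
Qed.

Lemma iter_mono n x y : (forall k, (k < n)%N -> P (iter k g x) = P (iter k g y)) ->
  u x <= u y -> forall j, (j <= n)%N -> reversed j x = reversed j y /\
  if reversed j x then u (iter j g y) <= u (iter j g x)
  else u (iter j g x) <= u (iter j g y).
Proof.
move=> Pxy uxy; elim=> [_|j IH jn].
  by split; rewrite /reversed !big_ord0.
have [rj uj] := IH (ltnW jn); have Pj := Pxy _ jn.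
have revS z : reversed j.+1 z = reversed j z (+) o (P (iter j g z)).
  by rewrite /reversed big_ord_recr/= oddD oddb.
rewrite !revS -rj -Pj; split => //.
case: (reversed j x) uj => /= uj.
  by have := mono (esym Pj) uj; rewrite -Pj; case: (o _).
by have := mono Pj uj; case: (o _).
Qed.

(** Inside one P-cylinder of length n, the whole list of n levels is thus encoded by a single number
    between 0 and n * m. *)
Lemma code_inj m n x y :
  (forall k, (k < n)%N -> P (iter k g x) = P (iter k g y)) ->
  code m n x = code m n y ->
  forall j, (j < n)%N -> level m (iter j g x) = level m (iter j g y).
Proof.
wlog uxy : x y / u x <= u y => [H|] Pxy cxy j jn.
  have [/H|/ltW/H] := leP (u x) (u y); first exact.
  by move=> H'; apply/esym/H' => // k /Pxy.
have mo := iter_mono Pxy uxy.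
have fh (k : 'I_n) : (code_term m k x <= code_term m k y)%N.
  have [rk uk] := mo _ (ltnW (ltn_ord k)).
  rewrite /code_term -rk; case: ifP uk => _ uk; last exact: le_level.
  by rewrite leq_sub2l// le_level.
have := sum_nat_eq fh cxy (Ordinal jn).
rewrite /= /code_term; have [<- _] := mo _ (ltnW jn).
case: ifP => // _ /eqP; rewrite eqn_sub2lE ?level_le// => /eqP.
exact.
Qed.

End monotone_coding.

(** * The entropy of an invariant measure is the entropy rate of the coding partition *)

Section coding_entropy.
Context {d : measure_display} {T : measurableType d} {R : realType}.
Variables (eta : probability T R) (g : T -> T).
Hypothesis mg : forall A, measurable A -> measurable (g @^-1` A).
Hypothesis invg : invariant_measure eta g.

Lemma measurable_label_ffun (K I : finType) (c : K -> T -> I) :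
  (forall k, measurable_label (c k)) ->
  measurable_label (fun x => [ffun k => c k x]).
Proof.
move=> mc w; rewrite (_ : _ @^-1` _ = \bigcap_(k in [set: K]) c k @^-1` [set w k]).
  by apply: fin_bigcap_measurable => // k _; exact: mc.
apply/seteqP; split=> [x /= <- k _ /=|x /= xw]; first by rewrite ffunE.
by apply/ffunP => k; rewrite ffunE; exact: xw.
Qed.

Variables (K I : finType) (P : T -> I) (r : nat -> R) (u : K -> T -> R).
Variable (o : K -> I -> bool).
Hypothesis mP : measurable_label P.
Hypothesis measurable_u : forall k a, measurable [set x | a < u k x].
Hypothesis mono : forall k x y, P x = P y -> u k x <= u k y ->
  if o k (P x) then u k (g y) <= u k (g x) else u k (g x) <= u k (g y).
Hypothesis gen : measurable `<=`
  <<s [set A | exists k i, A = [set x | r i < u k x] ] >>.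

Definition levels (m : nat) (x : T) : {ffun K -> 'I_m.+1} :=
  [ffun k => inord (level r (u k) m x)].

Definition codes (m n : nat) (x : T) : {ffun K -> 'I_(n * m).+1} :=
  [ffun k => inord (code g P r (u k) (o k) m n x)].

Lemma levelsP m x y : levels m x = levels m y <->
  forall k, level r (u k) m x = level r (u k) m y.
Proof.
split=> [/ffunP e k|e]; last by apply/ffunP => k; rewrite !ffunE e.
have := e k; rewrite !ffunE => /(congr1 val).
by rewrite /= !inordK// ltnS; exact: level_le.
Qed.

Lemma codesP m n x y : codes m n x = codes m n y <->
  forall k, code g P r (u k) (o k) m n x = code g P r (u k) (o k) m n y.
Proof.
split=> [/ffunP e k|e]; last by apply/ffunP => k; rewrite !ffunE e.
have := e k; rewrite !ffunE => /(congr1 val).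
by rewrite /= !inordK// ltnS; exact: code_le.
Qed.

Lemma measurable_levels m : measurable_label (levels m).
Proof.
apply: measurable_label_ffun => k.
pose c (i : 'I_m) x := r i < u k x.
have mc i : measurable_label (c i).
  move=> []; rewrite /c /=; first exact: measurable_u.
  rewrite (_ : _ @^-1` _ = ~` [set x | r i < u k x]); last first.
    by apply/seteqP; split=> x /=; [move=> ->|move/negP/negbTE].
  by apply: measurableC; exact: measurable_u.
apply: (measurable_label_factor (measurable_label_ffun mc)) => x y /ffunP e.
congr inord; apply: eq_bigr => i _; have := e i.
by rewrite !ffunE /c => ->.
Qed.

Lemma itineraryP (J : finType) (c : T -> J) n x y :
  itinerary g c n x = itinerary g c n y <->
  forall k, (k < n)%N -> c (iter k g x) = c (iter k g y).
Proof.
split=> [/ffunP e k kn|e].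
  by have := e (Ordinal kn); rewrite !ffunE.
by apply/ffunP => i; rewrite !ffunE e.
Qed.

Lemma measurable_codes m n : measurable_label (codes m n).
Proof.
have m1 := @measurable_itinerary _ _ _ mg _ _ n mP.
have m2 := @measurable_itinerary _ _ _ mg _ _ n (@measurable_levels m).
apply: (measurable_label_factor (measurable_label_pair m1 m2)) => x y [].
move=> /itineraryP Pxy /itineraryP lxy; apply/codesP => k.
apply: eq_bigr => j _; rewrite /code_term /reversed.
rewrite (eq_bigr (fun i : 'I_j => (o k (P (iter i g y)) : nat))) => [|i _].
  by have /levelsP/(_ k) -> := lxy _ (ltn_ord j).
by rewrite Pxy// (ltn_trans (ltn_ord i)).
Qed.

(** The P-itinerary and one code per coordinate determine the itinerary of the levels, and there are
    (n m + 1)^#|K| families of codes. *)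
Lemma entropy_levels m n :
  entropy eta (itinerary g (levels m) n) <=
  entropy eta (itinerary g P n) + #|K|%:R * ln (n * m).+1%:R.
Proof.
have m1 := @measurable_itinerary _ _ _ mg _ _ n mP.
have m2 := @measurable_codes m n.
have h := entropy_le_card eta m2.
have : ln #|{ffun K -> 'I_(n * m).+1}|%:R = #|K|%:R * ln (n * m).+1%:R :> R.
  by rewrite card_ffun card_ord natrX lnXn// mulr_natl.
move: h => /[swap] -> h.
apply: (@le_trans _ _ (entropy eta (itinerary g P n) + entropy eta (codes m n))).
  apply: le_trans (entropy_subadd eta m1 m2); apply: entropy_le.
    exact: measurable_label_pair.
  move=> x y [/itineraryP Pxy /codesP cxy]; apply/itineraryP => j jn.
  by apply/levelsP => k; apply: (code_inj (mono (k := k)) Pxy (cxy k)).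
by rewrite lerD2l.
Qed.

(** Approximation in measure by a union of level cells. It is required for every large m, so that
    finitely many sets can be approximated with the same m. *)
Definition approximable (A : set T) := measurable A /\
  forall eps, 0 < eps -> exists M, forall m, (M <= m)%N ->
  exists S : pred {ffun K -> 'I_m.+1},
    fine (eta [set x | (x \in A) (+) S (levels m x)]) <= eps.

Lemma measurable_xor (A : set T) m (S : pred {ffun K -> 'I_m.+1}) :
  measurable A -> measurable [set x | (x \in A) (+) S (levels m x)].
Proof.
move=> mA; pose c x := x \in A.
have mc : measurable_label c.
  move=> []; rewrite /c.
    by rewrite (_ : _ @^-1` _ = A)//; apply/seteqP; split=> x; [exact: set_mem|exact: mem_set].
  rewrite (_ : _ @^-1` _ = ~` A); first exact: measurableC.
  apply/seteqP; split=> x /= xA; first by move=> /mem_set; rewrite xA.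
  by apply/negbTE/negP => /set_mem.
pose z x := (c x, levels m x).
have mz : measurable_label z.
  by apply: measurable_label_pair => //; exact: measurable_levels.
have := measurable_label_comp (fun v => v.1 (+) S v.2) mz true.
by [].
Qed.

Lemma fine_measure_le (A B : set T) : measurable A -> measurable B ->
  A `<=` B -> fine (eta A) <= fine (eta B).
Proof.
by move=> mA mB AB; rewrite fine_le ?fin_num_measure// le_measure ?inE.
Qed.

Lemma fine_measureU_le (A B : set T) : measurable A -> measurable B ->
  fine (eta (A `|` B)) <= fine (eta A) + fine (eta B).
Proof.
move=> mA mB; rewrite -fineD ?fin_num_measure// fine_le ?fin_num_measure//.
- exact: measurableU.
- by rewrite fin_numD !fin_num_measure.
- exact: measureU2.
Qed.

(** A complement is approximated by the complementary union of cells, a finite union by the union of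
    the approximations, and a countable union by a finite one, up to e / 2, by continuity from
    below. *)
Lemma approximable_sigma : sigma_algebra setT approximable.
Proof.
split.
- split=> // eps e0; exists 0%N => m _; exists xpred0.
  rewrite (_ : [set x | _] = set0) ?measure0 ?ltW//.
  by apply/seteqP; split=> x //=; rewrite in_set0.
- move=> A [mA aA]; split; first exact: measurableD.
  move=> e /aA[M HM]; exists M => m /HM[S HS]; exists (predC S).
  rewrite (_ : [set x | _] = [set x | (x \in A) (+) S (levels m x)])//.
  apply/seteqP; split=> x /=; rewrite setTD in_setC;
    by case: (x \in A) => /=; case: (S _).
move=> A aA; have mA n : measurable (A n) by case: (aA n).
have mB n : measurable (\big[setU/set0]_(i < n) A i) by exact: bigsetU_measurable.
have aB n : approximable (\big[setU/set0]_(i < n) A i).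
  split=> //; elim: n => [|n IH] e e0.
    exists 0%N => m _; exists xpred0; rewrite big_ord0.
    rewrite (_ : [set x | _] = set0) ?measure0 ?ltW//.
    by apply/seteqP; split=> x //=; rewrite in_set0.
  have e20 : 0 < e / 2 by rewrite divr_gt0.
  have [M1 HM1] := IH _ e20; have [_ /(_ _ e20)[M2 HM2]] := aA n.
  exists (maxn M1 M2) => m; rewrite geq_max => /andP[/HM1[S1 HS1] /HM2[S2 HS2]].
  exists (predU S1 S2); rewrite [e]splitr.
  apply: le_trans (lerD HS1 HS2).
  apply: le_trans (fine_measureU_le _ _); [|exact: measurable_xor..].
  apply: fine_measure_le; [exact: measurable_xor| |].
    by apply: measurableU; exact: measurable_xor.
  move=> x /=; rewrite big_ord_recr/= in_setU.
  case: (x \in \big[_/_]_(_ < _) _) => /=; case: (x \in A n) => /=;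
    case: (S1 _) => /=; case: (S2 _) => //=; by [left|right].
have mbig : measurable (\bigcup_n A n) by exact: bigcupT_measurable.
split=> // e e0; have e20 : 0 < e / 2 by rewrite divr_gt0.
have [N HN] : exists N, fine (eta (\bigcup_n A n `\` \big[setU/set0]_(i < N) A i)) <= e / 2.
  have cB : (fun n => eta (\big[setU/set0]_(i < n) A i)) @ \oo --> eta (\bigcup_n A n).
    have AB : \bigcup_n A n = \bigcup_n \big[setU/set0]_(i < n) A i.
      apply/seteqP; split=> [x [n _ Anx]|x [n _]].
        by exists n.+1 => //; rewrite big_ord_recr/=; right.
      by rewrite -bigcup_mkord => -[i _ Aix]; exists i.
    rewrite AB; apply: nondecreasing_cvg_mu => //; first by rewrite -AB.
    by apply/nondecreasing_seqP => n; rewrite big_ord_recr/=; exact/subsetPset/subsetUl.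
  have /fine_cvgP[_ /cvgrPdist_le/(_ _ e20)[N _ HN]] :
      (fun n => eta (\big[setU/set0]_(i < n) A i)) @ \oo --> (fine (eta (\bigcup_n A n)))%:E.
    by rewrite fineK// fin_num_measure.
  exists N; have BA : \big[setU/set0]_(i < N) A i `<=` \bigcup_n A n.
    by move=> x; rewrite -bigcup_mkord => -[i _ Aix]; exists i.
  have fin A' : measurable A' -> eta A' \is a fin_num by exact: fin_num_measure.
  rewrite measureD//; last by rewrite ltey_eq fin.
  rewrite setIidr// fineB ?fin//.
  by apply: le_trans (HN N (leqnn N)); exact: ler_norm.
have [_ /(_ _ e20)[M HM]] := aB N.
exists M => m /HM[S HS]; exists S; rewrite [e]splitr.
apply: le_trans (lerD HN HS).
apply: le_trans (fine_measureU_le _ _);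
  [|by apply: measurableD|exact: measurable_xor].
apply: fine_measure_le; [exact: measurable_xor| |].
  by apply: measurableU; [exact: measurableD|exact: measurable_xor].
move=> x /=; have [xN|xN] := boolP (x \in \big[setU/set0]_(i < N) A i).
  have -> : x \in \bigcup_n A n.
    by move: xN; rewrite !inE -bigcup_mkord => -[i _ Aix]; exists i.
  by right.
have [xA|xA] := boolP (x \in \bigcup_n A n); last by right.
by move=> _; left; split; [exact: set_mem|move/mem_set; exact/negP].
Qed.

Lemma measurable_approximable : measurable `<=` approximable.
Proof.
move=> A /gen; apply: smallest_sub A; first exact: approximable_sigma.
move=> _ [k [i ->]]; split; first exact: measurable_u.
move=> e e0; exists i.+1 => m im.
(* The cells that meet the set. As i < m, the level decides the comparison with [r i], so the
   approximation is exact. *)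
exists (fun v => `[< exists y, levels m y = v /\ r i < u k y >]).
rewrite (_ : [set x | _] = set0) ?measure0 ?ltW//.
apply/seteqP; split=> x //=.
suff -> : (x \in [set x | r i < u k x]) = `[< exists y, levels m y = levels m x /\ r i < u k y >].
  by rewrite addbb.
apply/idP/asboolP; first by rewrite inE => rx; exists x.
move=> [y [/levelsP/(_ k) lyx ry]]; rewrite inE/=.
by rewrite -(level_inj im lyx).
Qed.

(* H(c | levels m) tends to 0 because the levels generate the sigma-algebra,
   while the itineraries of the levels cost at most ln (n m + 1) per coordinate
   more than those of P, which is sublinear in n. *)
Lemma rate_le (J : finType) (c : T -> J) (lc lP : R) :
  measurable_label c ->
  (fun n => entropy eta (itinerary g c n) / n%:R) @ \oo --> lc ->
  (fun n => entropy eta (itinerary g P n) / n%:R) @ \oo --> lP ->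
  lc <= lP.
Proof.
move=> mc clc clP; apply/ler_addgt0Pr => t' t'0.
have [t t0 ->] : exists2 t : R, 0 < t & t' = t + t.
  by exists (t' / 2); [rewrite divr_gt0|rewrite -splitr].
pose N : R := #|J|%:R.
have N0 : 0 < N by rewrite ltr0n; apply/card_gt0P; exists (c point).
(* [delta] and [eps] each contribute at most t / 2 to the bound of [cond_entropy_small]; the minimum
   with 1 makes [ln delta] nonpositive. *)
pose delta := Num.min 1 (t / (2 * N)).
have delta0 : 0 < delta by rewrite lt_min ltr01 divr_gt0// mulr_gt0.
have delta1 : delta <= 1 by rewrite ge_min lexx.
have lnd : ln delta <= 0 by exact: ln_le0.
have d1 : 0 < 1 - ln delta by lra.
pose eps := t / (2 * N) / (1 - ln delta).
have eps0 : 0 < eps by rewrite !divr_gt0// mulr_gt0.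
have small : N * (delta + eps * (1 - ln delta)) <= t.
  rewrite /eps mulfVK ?gt_eqF// mulrDr.
  have -> : N * (t / (2 * N)) = t / 2 by field; rewrite gt_eqF.
  have : N * delta <= N * (t / (2 * N)) by rewrite ler_pM2l// ge_min lexx orbT.
  have -> : N * (t / (2 * N)) = t / 2 by field; rewrite gt_eqF.
  lra.
have /choice[M HM] j := (measurable_approximable (mc j)).2 _ eps0.
(* One m that serves all the atoms of [c]. *)
pose m := (\max_j M j)%N.
have /choice[S HS] j := HM j m (leq_bigmax j).
have cm : cond_entropy eta c (levels m) <= t.
  apply: le_trans (cond_entropy_small mc (@measurable_levels m) (S := S)
    (eps := eps) (delta := delta) _ _) small.
    by rewrite delta0.
  move=> j; apply: le_trans (HS j); rewrite /mass le_eqVlt; apply/orP; left; apply/eqP.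
  congr (fine (eta _)); apply/seteqP; split=> x /=.
    by move=> xj; rewrite (_ : (x \in _) = (c x == j))//; apply/idP/eqP; rewrite inE.
  by rewrite (_ : (x \in _) = (c x == j))//; apply/idP/eqP; rewrite inE.
pose k : R := #|K|%:R.
(* The logarithm is linearised by ln v <= lam v - 1 - ln lam at v = n m + 1. With this [lam] the
   part proportional to n is at most t n, and [B] collects the terms free of n. *)
pose lam := t / (m.+1%:R * (k + 1)).
have k0 : 0 <= k by [].
have lam0 : 0 < lam by rewrite divr_gt0// mulr_gt0// ltr_wpDl.
pose B := k * (lam - 1 - ln lam).
have bound n : (0 < n)%N -> entropy eta (itinerary g c n) / n%:R <=
    entropy eta (itinerary g P n) / n%:R + (t + t) + B * n%:R^-1.
  move=> n0; have n0R : 0 < n%:R :> R by rewrite ltr0n.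
  rewrite ler_pdivrMr// !mulrDl !mulfVK ?gt_eqF//.
  have h1 := entropy_itinerary_cond mg invg n mc (@measurable_levels m).
  have h2 := entropy_levels m n.
  have h3 : entropy eta (itinerary g c n) <=
      entropy eta (fun x => (itinerary g c n x, itinerary g (levels m) n x)).
    apply: entropy_le; last by move=> x y [].
    by apply: measurable_label_pair; apply: measurable_itinerary => //; exact: measurable_levels.
  have h4 : n%:R * cond_entropy eta c (levels m) <= n%:R * t by rewrite ler_pM2l.
  have h5 : k * ln (n * m).+1%:R <= t * n%:R + B.
    have h : ln (n * m).+1%:R <= lam * (n * m).+1%:R - 1 - ln lam :> R.
      have := @ln_le_sub1 R (lam * (n * m).+1%:R).
      by rewrite lnM ?posrE// mulr_gt0// => /(_ isT); lra.
    have {}h := ler_wpM2l k0 h; apply: (le_trans h).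
    rewrite /B -natr1 natrM.
    suff : k * (lam * m%:R) <= t.
      by move=> /(ler_wpM2l (ltW n0R)); lra.
    rewrite /lam -[leRHS](@mulfVK _ (m.+1%:R * (k + 1))); last first.
      by rewrite gt_eqF// mulr_gt0// ltr_wpDl.
    rewrite mulrCA; apply: ler_wpM2l; first exact: ltW.
    have m0 : 0 <= m%:R :> R by [].
    by rewrite -[m.+1%:R]natr1 mulrDl mulrDr [k * _]mulrC -addrA lerDl mulr1 mul1r !addr_ge0.
  by rewrite {1}/cond_entropy in h1; rewrite -/k in h2; lra.
have cR : (fun n => entropy eta (itinerary g P n) / n%:R + (t + t) + B * n%:R^-1)
    @ \oo --> lP + (t + t) + B * 0.
  apply: cvgD; first by apply: cvgD => //; exact: cvg_cst.
  apply: cvgM; first exact: cvg_cst.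
  apply/cvgrPdist_le => e e0; near=> n; rewrite sub0r normrN ger0_norm//.
  rewrite invf_ple ?posrE//; last by rewrite ltr0n; near: n; exists 1%N.
  by near: n; exact: nbhs_infty_ger.
rewrite mulr0 addr0 in cR; apply: (ler_cvg_to clc cR).
by exists 1%N => // n; exact: bound.
Unshelve. all: by end_near. Qed.

(** The last clause is the source of upper semicontinuity: the entropy lies below every finite-time
    rate, and these rates will be continuous in the measure. *)
Lemma metric_entropy_coding : exists h : R, [/\ metric_entropy eta g = h%:E,
  (fun n => entropy eta (itinerary g P n) / n%:R) @ \oo --> h &
  forall n, (0 < n)%N -> h <= entropy eta (itinerary g P n) / n%:R].
Proof.
have [h [ch hle]] := entropy_itinerary_cvg mg invg mP.
exists h; split=> //; apply/eqP; rewrite eq_le; apply/andP; split.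
  apply: ub_ereal_sup => _ [k [Q [fQ ->]]].
  have [c mc Qc] := partition_label fQ.
  have [l [cl _]] := entropy_itinerary_cvg mg invg mc.
  rewrite lee_fin /partition_entropy.
  under eq_fun do rewrite (join_entropyE eta g _ Qc).
  by rewrite (cvg_lim _ cl)//; exact: rate_le mc cl ch.
apply: ereal_sup_ubound.
(* [finite_partition] wants nonempty blocks indexed by an ordinal, so only the labels attained by
   [P] are kept and numbered. *)
pose A := [pred i | `[< exists x, P x = i >] ].
have PA x : P x \in A by apply/asboolP; exists x.
pose c x : 'I_#|A| := enum_rank_in (PA point) (P x).
have Pc x y : P x = P y <-> c x = c y.
  split=> [|cxy]; first by rewrite /c => ->.
  by rewrite -(enum_rankK_in (PA point) (PA x)) -/(c x) cxy enum_rankK_in.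
have mc : measurable_label c by apply: measurable_label_factor mP _ => x y /Pc.
exists #|A|, (fun i => c @^-1` [set i]); split.
  split; last exact: mc; split.
  - by apply/seteqP; split=> // x _; exists (c x).
  - by move=> i j _ _ [x [/= -> ->]].
  - move=> i _; have /asboolP[x Px] := enum_valP i.
    by exists x; rewrite /= /c Px enum_valK_in.
rewrite /partition_entropy; congr (_%:E).
have Qc (i : 'I_#|A|) x : (c @^-1` [set i]) x <-> c x = i by [].
under eq_fun do rewrite (join_entropyE eta g _ Qc).
rewrite (_ : (fun n => _) = (fun n => entropy eta (itinerary g P n) / n%:R)).
  by rewrite (cvg_lim _ ch).
apply/funext => n; congr (_ / _); apply/eqP; rewrite eq_le; apply/andP; split.
  apply: entropy_le; first exact: measurable_itinerary.
  by move=> x y /itineraryP e; apply/itineraryP => k /e /Pc.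
apply: entropy_le; first exact: measurable_itinerary.
by move=> x y /itineraryP e; apply/itineraryP => k /e /Pc.
Qed.

End coding_entropy.

(** * Riesz representation *)

Section continuous_real.
Context {T : topologicalType} {R : realType}.
Implicit Types f g : T -> R.

Lemma continuous_add f g : continuous f -> continuous g ->
  continuous (fun x => f x + g x).
Proof. by move=> cf cg x; apply: cvgD; [exact: cf|exact: cg]. Qed.

Lemma continuous_mul f g : continuous f -> continuous g ->
  continuous (fun x => f x * g x).
Proof. by move=> cf cg x; apply: cvgM; [exact: cf|exact: cg]. Qed.

Lemma continuous_sub f g : continuous f -> continuous g ->
  continuous (fun x => f x - g x).
Proof. by move=> cf cg x; apply: cvgB; [exact: cf|exact: cg]. Qed.

Lemma continuous_cst (a : R) : continuous (fun _ : T => a).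
Proof. by move=> x; exact: cvg_cst. Qed.

Lemma continuous_scale (a : R) f : continuous f -> continuous (fun x => a * f x).
Proof. exact/continuous_mul/continuous_cst. Qed.

Definition clamp (a : R) : R := Num.min 1 (Num.max 0 a).

Lemma continuous_clamp f : continuous f -> continuous (fun x => clamp (f x)).
Proof.
move=> cf x; apply: (@continuous_min _ _ (fun=> 1) (fun x => Num.max 0 (f x))).
  exact: cvg_cst.
apply: (@continuous_max _ _ (fun=> 0) f); [exact: cvg_cst|exact: cf].
Qed.

Lemma clamp_ge0 a : 0 <= clamp a.
Proof. by rewrite le_min ler01 le_max lexx. Qed.

Lemma clamp_le1 a : clamp a <= 1.
Proof. by rewrite ge_min lexx. Qed.

Lemma clamp_le a b : a <= b -> clamp a <= clamp b.
Proof.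
move=> ab; rewrite le_min clamp_le1/= ge_min; apply/orP; right.
by rewrite ge_max le_max lexx/= le_max ab orbT.
Qed.

Lemma clamp_ge1 a : 1 <= a -> clamp a = 1.
Proof. by move=> a1; apply/min_idPl; rewrite le_max a1 orbT. Qed.

Lemma clamp_le0 a : a <= 0 -> clamp a = 0.
Proof. by move=> a0; rewrite /clamp (max_idPl a0); apply/min_idPr. Qed.

Lemma clamp_nat_eq1 (a : R) : 0 < a -> exists N, forall n, (N <= n)%N ->
  clamp (n%:R * a) = 1.
Proof.
move=> a0; exists (Num.truncn a^-1).+1 => n Nn; apply: clamp_ge1.
rewrite -ler_pdivrMr// div1r (le_trans (ltW (truncnS_gt _)))// ler_nat.
exact: Nn.
Qed.

End continuous_real.

Section riesz.
Context {T : ptopologicalType} {R : realType}.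
Implicit Types f g : T -> R.
Hypothesis compactT : compact [set: T].
Variable L : (T -> R) -> R.
Hypothesis LD : forall f g : T -> R, continuous f -> continuous g ->
  L (fun x => f x + g x) = L f + L g.
Hypothesis LZ : forall (a : R) (f : T -> R), continuous f -> L (fun x => a * f x) = a * L f.
Hypothesis L_ge0 : forall f : T -> R, continuous f -> (forall x, 0 <= f x) -> 0 <= L f.
Hypothesis L1 : L (fun=> 1) = 1.

Lemma functional_sub f g : continuous f -> continuous g ->
  L (fun x => f x - g x) = L f - L g.
Proof.
move=> cf cg.
rewrite (_ : (fun x => _) = (fun x => f x + -1 * g x)).
  by rewrite LD ?LZ ?mulN1r//; exact: continuous_scale.
by apply/funext => x; rewrite mulN1r.
Qed.

Lemma functional_le f g : continuous f -> continuous g ->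
  (forall x, f x <= g x) -> L f <= L g.
Proof.
move=> cf cg fg; rewrite -subr_ge0 -functional_sub//; apply: L_ge0.
  exact: continuous_sub.
by move=> x; rewrite subr_ge0.
Qed.

Lemma functional_sum (f : nat -> T -> R) n : (forall i, continuous (f i)) ->
  continuous (fun x => \sum_(i < n) f i x) /\
  L (fun x => \sum_(i < n) f i x) = \sum_(i < n) L (f i).
Proof.
move=> cf; elim: n => [|n [IHc IHL]].
  under eq_fun do rewrite big_ord0.
  split; first exact: continuous_cst.
  rewrite big_ord0 (_ : (fun=> 0) = (fun=> 0 * 1)); last by apply/funext => x; rewrite mul0r.
  by rewrite LZ ?mul0r//; exact: continuous_cst.
under eq_fun do rewrite big_ord_recr/=.
split; first exact: continuous_add.
by rewrite LD// IHL big_ord_recr.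
Qed.

(* Daniell's upper integral of the indicator of A: the infimum of sup_n L (h n)
   over increasing sequences of continuous functions with supremum >= 1 on A. *)
Definition covers (A : set T) (h : nat -> T -> R) (c : R) :=
  [/\ forall n, continuous (h n), forall n x, 0 <= h n x,
      forall n x, h n x <= h n.+1 x, forall n, L (h n) <= c &
      forall x, A x -> forall e, 0 < e -> exists n, 1 - e < h n x].

Definition cover_costs (A : set T) : set R :=
  [set c | exists h, covers A h c].

Definition outer (A : set T) : \bar R := (inf (cover_costs A))%:E.

Lemma covers1 A : cover_costs A 1.
Proof.
exists (fun=> fun=> 1); split=> //; last by move=> x _ e e0; exists 0%N; lra.
- by move=> n; exact: continuous_cst.
- by move=> n; rewrite L1.
Qed.

Lemma cover_costs_ge0 A c : cover_costs A c -> 0 <= c.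
Proof. by move=> [h [ch h0 _ Lc _]]; exact: le_trans (L_ge0 (ch 0%N) (h0 0%N)) (Lc 0%N). Qed.

Lemma has_inf_costs A : has_inf (cover_costs A).
Proof. by split; [exists 1; exact: covers1|exists 0 => c /cover_costs_ge0]. Qed.

Lemma outer_le A c : cover_costs A c -> (outer A <= c%:E)%E.
Proof. by move=> Ac; rewrite lee_fin ge_inf//; case: (has_inf_costs A). Qed.

Lemma outer_ge0 A : (0 <= outer A)%E.
Proof.
rewrite lee_fin; apply: lb_le_inf; first by exists 1; exact: covers1.
by move=> c /cover_costs_ge0.
Qed.

Lemma outer0 : outer set0 = 0%E.
Proof.
apply/eqP; rewrite eq_le outer_ge0 andbT; apply: outer_le.
exists (fun=> fun=> 0); split=> //; first by move=> n; exact: continuous_cst.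
move=> n; rewrite (_ : (fun=> 0) = (fun=> 0 * 1)); last by apply/funext => x; rewrite mul0r.
by rewrite LZ ?mul0r//; exact: continuous_cst.
Qed.

Lemma outer_homo A B : A `<=` B -> (outer A <= outer B)%E.
Proof.
move=> AB; rewrite lee_fin; apply: lb_le_inf; first by exists 1; exact: covers1.
move=> c [h [ch h0 hn Lc hB]]; rewrite -lee_fin; apply: outer_le.
by exists h; split=> // x /AB; exact: hB.
Qed.

Lemma covers_mono A h c : covers A h c -> forall x m n, (m <= n)%N -> h m x <= h n x.
Proof. by move=> [_ _ hn _ _] x; apply/nondecreasing_seqP => n; exact: hn. Qed.

(** Nearly optimal covers of the F n, with errors e / 2^(n+1), are added up into a cover of the
    union. *)
Lemma outer_sigma_subadditive : sigma_subadditive outer.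
Proof.
move=> F; apply/lee_addgt0Pr => e e0.
apply: le_trans (epsilon_trick xpredT (fun n => outer_ge0 (F n)) (ltW e0)).
have pos n : (0 <= outer (F n) + (e / (2 ^ n.+1)%:R)%:E)%E.
  by rewrite adde_ge0 ?outer_ge0// lee_fin divr_ge0// ltW.
set S := limn _; have S0 : (0 <= S)%E by apply: nneseries_ge0 => n _ _; exact: pos.
have : forall n, exists hc : (nat -> T -> R) * R,
    covers (F n) hc.1 hc.2 /\ (hc.2%:E <= outer (F n) + (e / (2 ^ n.+1)%:R)%:E)%E.
  move=> n; have en : 0 < e / (2 ^ n.+1)%:R by rewrite divr_gt0// ltr0n expn_gt0.
  have [c [h hc] lt] := inf_adherent en (has_inf_costs (F n)).
  by exists (h, c); split=> //; rewrite -EFinD lee_fin ltW.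
move=> /choice[hc hcP].
have [->|Sfin] := eqVneq S +oo%E; first exact: leey.
have {}Sfin : S \is a fin_num by rewrite fin_numElt (lt_le_trans _ S0)//= ltey.
rewrite -(fineK Sfin); apply: outer_le.
have mono := covers_mono (hcP _).1.
have cont i n : continuous ((hc i).1 n) by have [[]] := hcP i.
have h0 i n x : 0 <= (hc i).1 n x by have [[]] := hcP i.
(* The diagonal choice keeps every function a finite sum, hence continuous, while the sequence still
   increases. *)
exists (fun k x => \sum_(i < k) (hc i).1 k x); split.
- by move=> n; case: (functional_sum n (fun i => cont i n)).
- by move=> n x; rewrite sumr_ge0.
- move=> n x; rewrite big_ord_recr/= ler_wpDr// ler_sum// => i _.
  exact: mono.
- move=> n; case: (functional_sum n (fun i => cont i n)) => _ ->.
  apply: (@le_trans _ _ (\sum_(i < n) (hc i).2)).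
    by apply: ler_sum => i _; have [[]] := hcP i.
  rewrite -lee_fin fineK// -sumEFin -(big_mkord xpredT (fun i => ((hc i).2)%:E)).
  apply: le_trans (nneseries_lim_ge n (fun k _ _ => pos k)).
  by apply: lee_sum => i _; case: (hcP i).
move=> x [i _ Fix] d d0; have [[_ _ _ _ hF] _] := hcP i.
have [n hn] := hF x Fix d d0; exists (maxn n i.+1).
apply: (lt_le_trans hn).
have im : (i < maxn n i.+1)%N by rewrite leq_max leqnn orbT.
by rewrite (bigD1 (Ordinal im))//= ler_wpDr ?sumr_ge0// mono// leq_maxl.
Qed.

Definition outer_mu : {outer_measure set T -> \bar R} :=
  HB.pack_for (outer_measure R T) outer
    (isOuterMeasure.Build R T outer outer0 outer_ge0 outer_homo
      outer_sigma_subadditive).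

(** The functions g k = clamp (k u) increase to the indicator of A = {u > 0}. A cover h of X of cost
    c splits into h k * g k, which covers X inside A, and h (k + j) * (1 - g j), which covers X
    outside A. If j is chosen with L (h j * g j) within e of the supremum of L (h k * g k), the two
    costs add up to at most c + e. *)
Lemma caratheodory_cozero (u : T -> R) : continuous u ->
  outer.-caratheodory [set x | 0 < u x].
Proof.
move=> cu; apply: (@le_caratheodory_measurable _ _ outer_mu) => X /=.
set A := [set x | 0 < u x].
suff H c : cover_costs X c -> (outer (X `&` A) + outer (X `&` ~` A) <= c%:E)%E.
  rewrite -[leLHS]fineK// [leRHS]/outer lee_fin.
  apply: lb_le_inf; first by exists 1; exact: covers1.
  by move=> c /H; rewrite -EFinD lee_fin.
move=> [h hc]; have [ch h0 hn Lc hX] := hc; have mono := covers_mono hc.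
pose g k x := clamp (k%:R * u x).
have cg k : continuous (g k) by apply: continuous_clamp; exact: continuous_scale.
have g0 k x : 0 <= g k x by exact: clamp_ge0.
have g1 k x : g k x <= 1 by exact: clamp_le1.
have gS k x : g k x <= g k.+1 x.
  rewrite /g; have [u0|u0] := ltP 0 (u x); last first.
    by rewrite !clamp_le0// mulr_ge0_le0.
  by apply: clamp_le; rewrite ler_wpM2r ?(ltW u0)// ler_nat.
have chg k j : continuous (fun x => h k x * g j x) by exact: continuous_mul.
pose E := [set L (fun x => h k x * g k x) | k in [set: nat]].
have hsE : has_sup E.
  split; first by exists (L (fun x => h 0%N x * g 0%N x)), 0%N.
  exists c => _ [k _ <-]; apply: le_trans (Lc k).
  by apply: functional_le => // x; rewrite ler_piMr.
apply/lee_addgt0Pr => e e0.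
have [_ [j _ <-] sj] := sup_adherent e0 hsE.
have -> : (c%:E + e%:E = (sup E)%:E + (c - (sup E - e))%:E)%E.
  by rewrite -!EFinD; congr (_%:E); lra.
apply: leeD; apply: outer_le.
  exists (fun k x => h k x * g k x); split=> //.
  - by move=> n x; rewrite mulr_ge0.
  - by move=> n x; rewrite ler_pM.
  - by move=> n; apply: ub_le_sup; [case: hsE|exists n].
  move=> x [Xx Ax] d d0; have [n hd] := hX x Xx d d0.
  have [N gN] := clamp_nat_eq1 Ax; exists (maxn n N).
  by rewrite /g gN ?leq_maxr// mulr1 (lt_le_trans hd)// mono// leq_maxl.
(* The shift by j gives h (k + j) >= h j, so L (h (k + j) * g j) is at least the nearly optimal
   value. *)
exists (fun k x => h (k + j)%N x - h (k + j)%N x * g j x); split=> //.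
- by move=> n; exact: continuous_sub.
- by move=> n x; rewrite subr_ge0 ler_piMr.
- move=> n x; have := hn (n + j)%N x; rewrite addSn.
  have := g0 j x; have := g1 j x; nra.
- move=> n; rewrite functional_sub//.
  have : L (fun x => h j x * g j x) <= L (fun x => h (n + j)%N x * g j x).
    by apply: functional_le => // x; rewrite ler_wpM2r// mono// leq_addl.
  have := Lc (n + j)%N; lra.
move=> x [Xx /negP Ax] d d0; have [n hd] := hX x Xx d d0; exists n.
rewrite -leNgt in Ax; rewrite /g clamp_le0 ?mulr_ge0_le0// mulr0 subr0.
by rewrite (lt_le_trans hd)// mono// leq_addr.
Qed.

(** As in Dini's theorem, compactness yields one function of the increasing sequence that exceeds 1
    - e everywhere. *)
Lemma outer_setT : outer setT = 1%E.
Proof.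
apply/eqP; rewrite eq_le; apply/andP; split; first exact/outer_le/covers1.
rewrite lee_fin.
apply: lb_le_inf; first by exists 1; exact: covers1.
move=> c [h hc]; have [ch h0 hn Lc hX] := hc; have mono := covers_mono hc.
apply/ler_addgt0Pr => e e0.
have := compactT; rewrite compact_cover => /(_ nat setT (fun n => [set x | 1 - e < h n x])).
case.
- move=> n _; apply: (@open_comp _ _ (h n) [set y | 1 - e < y]); last exact: open_gt.
  by move=> x _; exact: ch.
- by move=> x _; have [n hd] := hX x I e e0; exists n.
move=> D _ Dcov; pose N := (\max_(i <- finmap.enum_fset D) i)%N.
have hN x : 1 - e <= h N x.
  have [i /= iD hi] := Dcov x I; apply: le_trans (ltW hi) _.
  by apply: mono; exact: leq_bigmax_seq.
suff : 1 - e <= L (h N) by have := Lc N; lra.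
have -> : 1 - e = L (fun=> (1 - e) * 1) by rewrite LZ ?L1 ?mulr1//; exact: continuous_cst.
by apply: functional_le => // [|x]; [exact: continuous_cst|rewrite mulr1].
Qed.

End riesz.

(** * Means of continuous functions on a compact space *)

Section borel_probability.
Context {T : ptopologicalType} {R : realType}.
Hypothesis compactT : compact [set: T].
Implicit Types f g : T -> R.

Lemma open_borel (A : set T) : open A -> measurable (A : set (borel T)).
Proof. by move=> oA; exact: sub_sigma_algebra. Qed.

Lemma continuous_borel f : continuous f -> measurable_fun setT (f : borel T -> R).
Proof.
move=> cf _; apply: (measurability _ (RGenOInfty.measurableE R)) => //.
move=> /= _ [_ [a ->]] <-; rewrite setTI; apply: open_borel.
apply: open_comp => [x _|]; first exact: cf.
by rewrite set_itvoy; exact: open_gt.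
Qed.

Lemma continuous_compact_bounded f : continuous f ->
  exists2 M, 0 < M & forall x, `|f x| <= M.
Proof.
move=> cf; have /compact_bounded[M [_ Mf]] :=
  continuous_compact (continuous_subspaceT cf) compactT.
exists (`|M| + 1); first by rewrite ltr_wpDl.
move=> x; apply: Mf; last by exists x.
by rewrite (le_lt_trans (ler_norm _))// ltrDl.
Qed.

Variable eta : probability (borel T) R.

Lemma continuous_integrable f : continuous f -> eta.-integrable setT (EFin \o f).
Proof.
move=> cf; apply: measurable_bounded_integrable => //.
- by rewrite (le_lt_trans (probability_le1 _ _)) ?ltry.
- exact: continuous_borel.
have [M _ fM] := continuous_compact_bounded cf.
by exists M; split; rewrite ?num_real// => N /ltW MN x _ /=; exact: le_trans MN.
Qed.

Definition mean f : R := fine (\int[eta]_x (f x)%:E)%E.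

Lemma meanE f : continuous f -> (\int[eta]_x (f x)%:E)%E = (mean f)%:E.
Proof. by move=> /continuous_integrable cf; rewrite fineK// integrable_fin_num. Qed.

Lemma meanD f g : continuous f -> continuous g ->
  mean (fun x => f x + g x) = mean f + mean g.
Proof.
by move=> cf cg; apply: (@RintegralD _ _ _ eta setT f g) => //; exact: continuous_integrable.
Qed.

Lemma meanZ a f : continuous f -> mean (fun x => a * f x) = a * mean f.
Proof.
by move=> cf; apply: (@RintegralZl _ _ _ eta setT f a) => //; exact: continuous_integrable.
Qed.

Lemma mean_ge0 f : (forall x, 0 <= f x) -> 0 <= mean f.
Proof. by move=> f0; apply: (@Rintegral_ge0 _ _ _ eta setT f) => x _; exact: f0. Qed.

Lemma mean_cst a : mean (fun=> a) = a.
Proof. by rewrite /mean integral_cst//= probability_setT mule1. Qed.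

Lemma mean_le f g : continuous f -> continuous g -> (forall x, f x <= g x) ->
  mean f <= mean g.
Proof.
move=> cf cg fg; apply: (@le_Rintegral _ _ _ eta setT f g) => //;
  by [exact: continuous_integrable|move=> x _; exact: fg].
Qed.

Lemma mean_dist f g e : continuous f -> continuous g ->
  (forall x, `|f x - g x| <= e) -> `|mean f - mean g| <= e.
Proof.
move=> cf cg fg; rewrite ler_distl.
have ce : continuous (fun _ : T => e) by exact: continuous_cst.
have h1 : mean f <= mean g + e.
  rewrite -[X in _ + X](mean_cst e) -meanD//; apply: mean_le => //.
    exact: continuous_add.
  by move=> x; have := fg x; rewrite ler_distl; lra.
have h2 : mean g <= mean f + e.
  rewrite -[X in _ + X](mean_cst e) -meanD//; apply: mean_le => //.
    exact: continuous_add.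
  by move=> x; have := fg x; rewrite ler_distl; lra.
lra.
Qed.

End borel_probability.

(** * Integration against the Daniell measure recovers the functional *)

Section riesz_representation.
Context {T : ptopologicalType} {R : realType}.
Implicit Types f g : T -> R.
Hypothesis compactT : compact [set: T].
Hypothesis open_cozero : @open T `<=`
  <<s [set A | exists2 u : T -> R, continuous u & A = [set x | 0 < u x] ] >>.
Variable L : (T -> R) -> R.
Hypothesis LD : forall f g : T -> R, continuous f -> continuous g ->
  L (fun x => f x + g x) = L f + L g.
Hypothesis LZ : forall (a : R) (f : T -> R), continuous f ->
  L (fun x => a * f x) = a * L f.
Hypothesis L_ge0 : forall f : T -> R, continuous f -> (forall x, 0 <= f x) -> 0 <= L f.
Hypothesis L1 : L (fun=> 1) = 1.

Let omu := outer_mu LD LZ L_ge0 L1.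

Lemma borel_caratheodory : @measurable _ (borel T) `<=`
  @measurable _ (caratheodory_type omu).
Proof.
apply: smallest_sub; first exact: (@sigma_algebra_measurable _ (caratheodory_type omu)).
move=> A /open_cozero; apply: smallest_sub A.
  exact: (@sigma_algebra_measurable _ (caratheodory_type omu)).
by move=> _ [u cu ->]; exact: (caratheodory_cozero LD LZ L_ge0 L1 cu).
Qed.

Lemma riesz_probability : exists mu : probability (borel T) R,
  forall A, mu A = outer L A.
Proof.
have s : semi_sigma_additive (outer L : set (borel T) -> \bar R).
  move=> F mF tF mUF.
  apply: (@caratheodory_measure_sigma_additive _ _ omu F) => // [i|].
    exact: borel_caratheodory.
  exact: borel_caratheodory.
pose ism := isMeasure.Build _ (borel T) R (outer L) (outer0 LZ L_ge0 L1)
  (outer_ge0 L_ge0 L1) s.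
pose m : {measure set (borel T) -> \bar R} :=
  HB.pack_for (measure (borel T) R) (outer L : set (borel T) -> \bar R) ism.
have mT : m setT = 1%E by exact: (outer_setT compactT LD LZ L_ge0 L1).
pose P : probability (borel T) R :=
  HB.pack_for (probability (borel T) R) (Measure.sort m)
    (Measure.class m) (Measure_isProbability.Build _ _ _ m mT).
by exists P.
Qed.

(** [clamp (a - j)] is the length of [0,a] inside the slice [j,j+1]. *)
Lemma sum_clamp (a : R) n : 0 <= a -> \sum_(j < n) clamp (a - j%:R) = Num.min a n%:R.
Proof.
move=> a0; elim: n => [|n IH]; first by rewrite big_ord0 (min_idPr a0).
rewrite big_ord_recr/= IH -natr1.
have [an|an] := leP a n%:R.
  by rewrite clamp_le0 ?subr_le0// addr0; apply/esym/min_idPl; lra.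
rewrite /clamp (@max_idPr _ _ 0 (a - n%:R) _); last by lra.
by have [h|h] := leP a (n%:R + 1); [rewrite (min_idPr _)|rewrite (min_idPl _)]; lra.
Qed.

Lemma min_le_sum_indic (a : R) n : Num.min a n.+1%:R <= 1 + \sum_(j < n) (j.+1%:R <= a)%R%:R.
Proof.
elim: n => [|n IH]; first by rewrite big_ord0 addr0 ge_min lexx orbT.
rewrite big_ord_recr/= addrA.
have [h|h] := leP n.+1%:R a.
  apply: (@le_trans _ _ (n.+1%:R + 1)); first by rewrite natr1 ge_min lexx orbT.
  by rewrite lerD2r; move: IH; rewrite (min_idPr h).
by rewrite addr0; move: IH; rewrite (min_idPl (ltW h)); apply: le_trans; rewrite ge_min lexx.
Qed.

Lemma outer_le_functional f : continuous f -> (forall x, 0 <= f x) ->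
  forall A, (forall x, A x -> 1 <= f x) -> (outer L A <= (L f)%:E)%E.
Proof.
move=> cf f0 A Af; apply: (outer_le L_ge0 L1); exists (fun=> f); split=> //.
by move=> x Ax e e0; exists 0%N; have := Af x Ax; lra.
Qed.

(** Layer cake: n f is at most 1 plus the sum of the indicators of A j = {n f >= j + 1}. The slice c
    j = clamp (n f - j) equals 1 on A j, so mu (A j) <= L (c j), and the slices add up to n f.
    Dividing by n leaves an error 1 / n. *)
Lemma mean_le_functional (mu : probability (borel T) R) f :
  (forall A, mu A = outer L A) -> continuous f ->
  (forall x, 0 <= f x <= 1) -> mean mu f <= L f.
Proof.
move=> muE cf f01; apply/ler_addgt0Pr => e e0.
pose n := (Num.truncn e^-1).+1.
have n0 : 0 < n%:R :> R by rewrite ltr0n.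
have ne : n%:R^-1 <= e by rewrite invf_ple ?posrE// ltW// truncnS_gt.
pose A (j : nat) := [set x | j.+1%:R <= n%:R * f x].
have cnf : continuous (fun x => n%:R * f x) by exact: continuous_scale.
have mA j : measurable (A j : set (borel T)).
  rewrite -[A j]setTI (_ : A j = (fun x => n%:R * f x) @^-1` `[j.+1%:R, +oo[).
    by apply: (continuous_borel cnf) => //; exact: measurable_itv.
  by apply/seteqP; split=> y /=; rewrite in_itv/= andbT.
pose c j x := clamp (n%:R * f x - j%:R).
have cc j : continuous (c j).
  by apply: continuous_clamp; apply: continuous_sub => //; exact: continuous_cst.
have nf x : 0 <= n%:R * f x <= n%:R.
  by have /andP[f0 f1] := f01 x; rewrite mulr_ge0 ?(ltW n0)//= ler_piMr ?(ltW n0).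
have Lc : \sum_(j < n) L (c j) = n%:R * L f.
  rewrite -LZ// -(functional_sum LD LZ n cc).2; congr L; apply/funext => x.
  by have /andP[nf0 nf1] := nf x; rewrite /c sum_clamp// (min_idPl nf1).
have mun : ((mean mu (fun x => (n%:R * f x)%R))%:E <= (1 + n%:R * L f)%R%:E)%E.
  rewrite -meanE//.
  apply: (@le_trans _ _ (\int[mu]_x (1 + \sum_(j < n) (\1_(A j) x)%:E))%E).
    apply: ge0_le_integral => //.
    - by move=> x _; rewrite lee_fin; case/andP: (nf x).
    - by apply/measurable_EFinP; exact: continuous_borel.
    - apply: emeasurable_funD => //; apply: emeasurable_sum => j.
      by apply/measurable_EFinP; exact: measurable_indic.
    move=> x _; rewrite sumEFin -EFinD lee_fin.
    have /andP[nf0 nf1] := nf x; have := min_le_sum_indic (n%:R * f x) n.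
    rewrite (min_idPl _); last by rewrite (le_trans nf1)// ler_nat.
    move=> /le_trans; apply; rewrite lerD2l ler_sum// => j _.
    rewrite indicE (_ : (x \in A j) = (j.+1%:R <= n%:R * f x))//.
    by apply/idP/idP => [/set_mem|h]; [|exact/mem_set].
  rewrite ge0_integralD//; last 2 first.
  - by move=> x _; apply: sume_ge0 => j _; rewrite lee_fin.
  - by apply: emeasurable_sum => j; apply/measurable_EFinP; exact: measurable_indic.
  rewrite integral_cst//= probability_setT mule1 EFinD; apply: leeD2l.
  have mind j : measurable_fun setT (fun x : borel T => (\1_(A j) x : R)%:E).
    by apply/measurable_EFinP; exact: measurable_indic.
  rewrite ge0_integral_sum//.
  rewrite -Lc -sumEFin; apply: lee_sum => j _.
  rewrite integral_indic// setIT.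
  apply: (@le_trans _ _ (outer L (A j))); first by rewrite -muE.
  apply: outer_le_functional => // x.
    exact: clamp_ge0.
  by rewrite /A /= -natr1 => h; rewrite /c clamp_ge1//; lra.
rewrite lee_fin meanZ// in mun.
have : mean mu f <= n%:R^-1 + L f.
  by rewrite -(ler_pM2l n0) mulrDr divff ?gt_eqF.
lra.
Qed.

(** For values in [0,1], the inequality applied to 1 - f gives the reverse one. A general f, bounded
    by M, is brought into [0,1] by an affine change. *)
Lemma riesz : exists mu : probability (borel T) R,
  forall f, continuous f -> mean mu f = L f.
Proof.
have [mu muE] := riesz_probability; exists mu.
have eq01 f : continuous f -> (forall x, 0 <= f x <= 1) -> mean mu f = L f.
  move=> cf f01; apply/eqP; rewrite eq_le mean_le_functional//=.
  have c1 : continuous (fun _ : T => 1 : R) by exact: continuous_cst.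
  have := @mean_le_functional mu (fun x => 1 + -1 * f x) muE.
  rewrite meanD ?mean_cst ?meanZ ?LD ?LZ ?L1//; last 2 first.
  - exact: continuous_scale.
  - exact: continuous_scale.
  rewrite !mulN1r lerD2l lerN2; apply.
    by apply: continuous_add => //; exact: continuous_scale.
  by move=> x; have := f01 x; lra.
move=> f cf; have [M M0 fM] := continuous_compact_bounded compactT cf.
pose g x := 2^-1 * (M^-1 * f x + 1).
have c1 : continuous (fun _ : T => 1 : R) by exact: continuous_cst.
have cg1 : continuous (fun x => M^-1 * f x) by exact: continuous_scale.
have cg2 : continuous (fun x => M^-1 * f x + 1) by exact: continuous_add.
have cg : continuous g by exact: continuous_scale.
have g01 x : 0 <= g x <= 1.
  have := fM x; rewrite ler_norml => /andP[f1 f2].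
  have h1 : -1 <= M^-1 * f x by rewrite ler_pdivlMl// mulrN1.
  have h2 : M^-1 * f x <= 1 by rewrite ler_pdivrMl// mulr1.
  by rewrite /g; lra.
have := eq01 g cg g01.
rewrite /g meanZ// LZ// meanD// LD// mean_cst L1 meanZ// LZ//.
by move=> /(mulfI (invr_neq0 (lt0r_neq0 (ltr0n R 2))))/addIr/(mulfI (invr_neq0 (lt0r_neq0 M0))).
Qed.

End riesz_representation.

(** * Determining families and weak limits *)

Section determining_family.
Context {T : ptopologicalType} {R : realType} {K : finType}.
Hypothesis compactT : compact [set: T].
Variables (u : K -> T -> R) (r : nat -> R).
Hypothesis cu : forall k, continuous (u k).
Hypothesis open_gen : @open T `<=`
  <<s [set A | exists k i, A = [set x | r i < u k x] ] >>.

(** The countable determining family. As j grows, [bump l j] increases to the indicator of the open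
    set [quadrant l]. *)
Fixpoint bump (l : seq (K * nat)) (j : nat) (x : T) : R :=
  if l is ki :: l' then clamp (j%:R * (u ki.1 x - r ki.2)) * bump l' j x else 1.

Definition quadrant (l : seq (K * nat)) : set T :=
  [set x | all (fun ki => r ki.2 < u ki.1 x) l].

Lemma continuous_bump l j : continuous (bump l j).
Proof.
elim: l => [|ki l IH] /=; first exact: continuous_cst.
apply: continuous_mul => //; apply: continuous_clamp; apply: continuous_scale.
by apply: continuous_sub => //; exact: continuous_cst.
Qed.

Lemma bump_ge0 l j x : 0 <= bump l j x.
Proof. by elim: l => //= ki l IH; rewrite mulr_ge0// clamp_ge0. Qed.

Lemma bump_le1 l j x : bump l j x <= 1.
Proof.
elim: l => //= ki l IH.
by rewrite -[leRHS](mulr1 1) ler_pM ?clamp_ge0 ?bump_ge0 ?clamp_le1.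
Qed.

Lemma bump_homo l x : {homo (bump l)^~ x : m n / (m <= n)%N >-> m <= n}.
Proof.
move=> m n mn; elim: l => //= ki l IH.
rewrite ler_pM ?clamp_ge0 ?bump_ge0//.
have [h|h] := leP (u ki.1 x - r ki.2) 0.
  by rewrite !clamp_le0// mulr_ge0_le0.
by apply: clamp_le; rewrite ler_wpM2r ?(ltW h)// ler_nat.
Qed.

Lemma bump_near l x :
  exists N, forall n, (N <= n)%N -> bump l n x = \1_(quadrant l) x.
Proof.
rewrite indicE; elim: l => [|ki l [N IH]] /=.
  by exists 0%N => n _; rewrite mem_set.
have [h|h] := ltP (r ki.2) (u ki.1 x); last first.
  exists 0%N => n _; rewrite clamp_le0 ?mul0r; last by rewrite mulr_ge0_le0// subr_le0.
  rewrite (_ : x \in _ = false)//; apply/negbTE/negP => /set_mem/= /andP[].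
  by rewrite ltNge h.
have [|M HM] := @clamp_nat_eq1 R (u ki.1 x - r ki.2); first by rewrite subr_gt0.
exists (maxn M N) => n; rewrite geq_max => /andP[/HM -> /IH ->]; rewrite mul1r.
by congr (nat_of_bool _)%:R; apply/idP/idP => /set_mem qx; apply/mem_set;
  move: qx; rewrite /quadrant/= h.
Qed.

Lemma quadrant_borel l : measurable (quadrant l : set (borel T)).
Proof.
elim: l => [|[k i] l IH].
  by rewrite (_ : quadrant [::] = setT)//; apply/seteqP; split.
rewrite (_ : quadrant _ = [set x | r i < u k x] `&` quadrant l).
  apply: measurableI => //; apply: open_borel.
  by apply: (@open_comp _ _ (u k) [set y | r i < y]) => [x _|]; [exact: cu|exact: open_gt].
by apply/seteqP; split=> x /=; rewrite /quadrant/= => /andP.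
Qed.

Lemma measure_quadrant (eta : probability (borel T) R) l :
  (mean eta (bump l n))%:E @[n --> \oo] --> eta (quadrant l).
Proof.
have -> : eta (quadrant l) = (\int[eta]_x limn (fun n => (bump l n x)%:E))%E.
  rewrite -[LHS]/(eta _) -[quadrant l]setIT -integral_indic//; last exact: quadrant_borel.
  apply: eq_integral => x _; apply/esym/cvg_lim => //.
  apply: cvg_near_cst; have [N HN] := bump_near l x.
  by exists N => // n /= /HN ->.
rewrite (_ : (fun n => (mean eta (bump l n))%:E) =
    (fun n => (\int[eta]_x (bump l n x)%:E)%E)); last first.
  by apply/funext => n; rewrite (meanE compactT)//; exact: continuous_bump.
apply: cvg_monotone_convergence => //.
- by move=> n; apply/measurable_EFinP; exact: (continuous_borel (@continuous_bump l n)).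
- by move=> n x _; rewrite lee_fin bump_ge0.
- by move=> x _ m n mn; rewrite lee_fin bump_homo.
Qed.

(** Quadrants form a pi-system, intersection being concatenation of lists, and they generate the
    Borel sets. Their measures are limits of means of bumps. *)
Lemma eq_measure_mean (eta eta' : probability (borel T) R) :
  (forall l j, mean eta (bump l j) = mean eta' (bump l j)) ->
  forall A : set (borel T), measurable A -> eta A = eta' A.
Proof.
move=> H A mA.
pose G : set (set (borel T)) := [set quadrant l | l in setT].
have GT (x : nat) : G setT.
  by exists [::] => //; apply/seteqP; split.
apply: (@g_sigma_algebra_measure_unique _ R (borel T) G _ (fun=> setT)) => //.
- by move=> _ [l _ <-]; exact: quadrant_borel.
- by apply/seteqP; split=> // x _; exists 0%N.
- move=> _ _ [l1 _ <-] [l2 _ <-]; exists (l1 ++ l2) => //.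
  by apply/seteqP; split=> x; rewrite /quadrant/= all_cat => /andP.
- move=> _ [l _ <-].
  have e (m : probability (borel T) R) :
      m (quadrant l) = lim ((mean m (bump l n))%:E @[n --> \oo]).
    by apply/esym/cvg_lim => //; exact: measure_quadrant.
  apply: etrans (e eta) _; apply: etrans _ (esym (e eta')).
  by under eq_fun do rewrite H.
- by move=> _; exact: le_lt_trans (probability_le1 eta measurableT) (ltry _).
move: mA; apply: smallest_sub A; first exact: smallest_sigma_algebra.
move=> A /open_gen; apply: smallest_sub A; first exact: smallest_sigma_algebra.
move=> _ [k [i ->]]; apply: sub_sigma_algebra; exists [:: (k, i)] => //.
by apply/seteqP; split=> x; rewrite /quadrant/= andbT.
Qed.

End determining_family.

Section weak_limit.
Context {T : ptopologicalType} {R : realType}.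
Hypothesis compactT : compact [set: T].
Hypothesis open_cozero : @open T `<=`
  <<s [set A | exists2 u : T -> R, continuous u & A = [set x | 0 < u x] ] >>.

Lemma compact_ultra_cvg (I : Type) (X : topologicalType) (A : set X)
    (U : set_system I) (a : I -> X) :
  compact A -> UltraFilter U -> (forall n, A (a n)) ->
  exists2 l, A l & a @ U --> l.
Proof.
move=> cA UU aA.
have FU : ProperFilter (a @ U) by exact: fmap_proper_filter.
have [|l [Al cl]] := cA (a @ U) FU.
  by apply: (@filterS _ U _ setT); [move=> n _; exact: aA|exact: filterT].
exists l => // B lB; have [//|nB] := in_ultra_setVsetC (a @^-1` B) UU.
by have [x [/= xB]] := cl (~` B) B nB lB.
Qed.

(** The means of a continuous function stay in a segment, so they converge along U, and the limit is
    a normalized positive functional. For other functions [L] may be a default value; the hypotheses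
    of [riesz] concern continuous ones. *)
Lemma weak_limit (I : Type) (U : set_system I) (eta : I -> probability (borel T) R) :
  UltraFilter U -> exists mu : probability (borel T) R,
  forall f, continuous f -> (fun n => mean (eta n) f) @ U --> mean mu f.
Proof.
move=> UU; pose L (f : T -> R) : R := lim (mean (eta n) f @[n --> U]).
have cL f : continuous f -> (fun n => mean (eta n) f) @ U --> L f.
  move=> cf; have [M M0 fM] := continuous_compact_bounded compactT cf.
  have [|l _ cl] := compact_ultra_cvg (@segment_compact R (- M) M) UU
    (a := fun n => mean (eta n) f).
    move=> n; rewrite /= in_itv/= -ler_norml.
    rewrite -[mean _ _]subr0 -(mean_cst (eta n) 0).
    apply: (mean_dist compactT) => //; first exact: continuous_cst.
    by move=> x; rewrite subr0.
  by rewrite /L (cvg_lim _ cl).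
have [] := @riesz T R compactT open_cozero L.
- move=> f g cf cg; apply/cvg_lim => //.
  under eq_fun do rewrite (meanD compactT)//.
  by apply: cvgD; exact: cL.
- move=> a f cf; apply/cvg_lim => //.
  under eq_fun do rewrite (meanZ compactT)//.
  by apply: cvgM; [exact: cvg_cst|exact: cL].
- move=> f cf f0; apply: (cvgr_to_ge (cL _ cf)); apply: filterE => n.
  exact: mean_ge0.
- by apply/cvg_lim => //; under eq_fun do rewrite mean_cst; exact: cvg_cst.
by move=> mu muL; exists mu => f cf; rewrite muL//; exact: cL.
Qed.

End weak_limit.

(** * Images of measures under a continuous map *)

Section continuous_dynamics.
Context {T : ptopologicalType} {R : realType}.
Hypothesis compactT : compact [set: T].
Variable g : T -> T.
Hypothesis cg : continuous g.

Lemma borel_preimage (A : set (borel T)) : measurable A ->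
  measurable (g @^-1` A : set (borel T)).
Proof.
pose mA := [set A : set (borel T) | measurable (g @^-1` A : set (borel T))].
apply: (@smallest_sub _ (sigma_algebra setT) _ mA); last first.
  by move=> B oB; apply: open_borel; apply: open_comp => // x _; exact: cg.
split.
- by rewrite /mA /= preimage_set0.
- by move=> B mB; rewrite /mA /= setTD preimage_setC; exact: measurableC.
- by move=> F mF; rewrite /mA /= preimage_bigcup; exact: bigcupT_measurable.
Qed.

(** Makes invariance an equality between two probabilities, which can then be tested on means. *)
Lemma continuous_image (eta : probability (borel T) R) :
  exists nu : probability (borel T) R,
    (forall A, nu A = eta (g @^-1` A)) /\
    (forall f : T -> R, continuous f -> mean nu f = mean eta (f \o g)).
Proof.
have mg : measurable_fun setT (g : borel T -> borel T).
  by move=> _ A mA; rewrite setTI; exact: borel_preimage.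
pose X : {mfun (borel T) >-> (borel T)} :=
  HB.pack_for {mfun (borel T) >-> (borel T)} (g : borel T -> borel T)
    (isMeasurableFun.Build _ _ (borel T) (borel T) g mg).
exists (distribution eta X); split=> // f cf; rewrite /mean.
rewrite (@integral_pushforward _ _ (borel T) (borel T) R g mg eta setT)//.
- by apply/measurable_EFinP; exact: continuous_borel.
- rewrite preimage_setT; apply: (@continuous_integrable _ _ compactT eta (f \o g)).
  by move=> x; apply: continuous_comp; [exact: cg|exact: cf].
Qed.

Lemma mean_invariant (eta : probability (borel T) R) (f : T -> R) :
  invariant_measure eta g -> continuous f -> mean eta (f \o g) = mean eta f.
Proof.
move=> inv cf; have [nu [nuE <-//]] := continuous_image eta.
rewrite /mean; congr fine; apply: eq_measure_integral => A mA _.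
exact: etrans (nuE A) (inv A mA).
Qed.

Lemma continuous_iter n : continuous (iter n g).
Proof.
elim: n => [|n IH] x /=; first exact: cvg_id.
by apply: (continuous_comp (IH x)); exact: cg.
Qed.

End continuous_dynamics.

Section clopen_labels.
Context {T : ptopologicalType} {R : realType}.
Implicit Types (I : finType).

(** With all fibres open, each fibre is also closed, and its indicator is continuous. *)
Definition open_label (I : Type) (c : T -> I) := forall i, open (c @^-1` [set i]).

Lemma open_label_measurable I (c : T -> I) :
  open_label c -> measurable_label (c : borel T -> I).
Proof. by move=> oc i; exact: open_borel. Qed.

Lemma open_label_continuous (I : Type) (c : T -> I) (f : I -> R) :
  open_label c -> continuous (f \o c).
Proof.
move=> oc x; apply: cvg_near_cst.
have : nbhs x (c @^-1` [set c x]) by apply: open_nbhs_nbhs; split.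
by apply: filterS => y /= ->.
Qed.

Lemma open_label_itinerary (g : T -> T) I (c : T -> I) n :
  continuous g -> open_label c -> open_label (itinerary g c n).
Proof.
move=> cg oc w; rewrite openE => x /= <-; rewrite /interior /=.
have h (i : 'I_n) : nbhs x ((c \o iter i g) @^-1` [set c (iter i g x)]).
  apply: open_nbhs_nbhs; split => //.
  by apply: (open_comp _ (oc _)) => y _; exact: continuous_iter.
have H : \forall y \near x, forall i : 'I_n, c (iter i g y) = c (iter i g x).
  exact: filter_forall.
by apply: filterS H => y hy; apply/ffunP => i; rewrite !ffunE; exact: hy.
Qed.

Lemma mass_mean (eta : probability (borel T) R) I (c : T -> I) i :
  open_label c -> mass eta c i = mean eta (fun x => (c x == i)%:R).
Proof.
move=> oc; rewrite /mass /mean; congr fine.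
rewrite -[LHS]/(eta _) -[c @^-1` _]setIT -integral_indic//; last exact: open_borel.
apply: eq_integral => x _; rewrite indicE; congr (_%:R%:E).
by congr nat_of_bool; apply/idP/eqP => [/set_mem|/mem_set].
Qed.

End clopen_labels.

Section xlnx.
Context {R : realType}.

(** This is t ln (delta / t) <= delta - t; it controls t ln t near 0, where [ln] itself is not
    continuous. *)
Lemma xlnx_small (t delta : R) : 0 <= t <= 1 -> 0 < delta ->
  `|t * ln t| <= delta - t * ln delta.
Proof.
move=> /andP[t0 t1] d0.
have := t0; rewrite le_eqVlt => /predU1P[<-|tp].
  by rewrite !mul0r normr0 subr0 ltW.
rewrite ler0_norm; last by rewrite mulr_ge0_le0// ln_le0.
have := ln_le_sub1 (divr_gt0 d0 tp) => /(ler_wpM2l t0).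
rewrite ln_div ?posrE// !mulrBr mulrCA divff ?gt_eqF// !mulr1; lra.
Qed.

Lemma cvg_xlnx (I : Type) (F : set_system I) (t : I -> R) (l : R) :
  ProperFilter F -> (forall n, 0 <= t n <= 1) -> t @ F --> l ->
  (fun n => t n * ln (t n)) @ F --> l * ln l.
Proof.
move=> FF t01 tl.
have l0 : 0 <= l by apply: (cvgr_to_ge tl); apply: nearW => n; case/andP: (t01 n).
have := l0; rewrite le_eqVlt => /predU1P[l_0|lp]; last first.
  by apply: cvgM => //; apply: continuous_cvg => //; exact: continuous_ln.
rewrite -l_0 mul0r; apply/cvgrPdist_le => e e0.
(* [xlnx_small] bounds |t ln t| by delta + t |ln delta|; the second term is at most delta once t <=
   delta / C. *)
pose delta := e / 2; have d0 : 0 < delta by rewrite divr_gt0.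
pose C := 1 + `|ln delta|; have C0 : 0 < C by rewrite ltr_wpDr.
move: tl; rewrite -l_0 => /cvgrPdist_le/(_ (delta / C) (divr_gt0 d0 C0)).
apply: filterS => n; rewrite !sub0r !normrN => tn.
have /andP[tn0 tn1] := t01 n; rewrite ger0_norm// in tn.
apply: le_trans (xlnx_small (t01 n) d0) _.
have : t n * C <= delta by rewrite -ler_pdivlMr.
have : t n * - ln delta <= t n * C.
  by rewrite ler_wpM2l// (le_trans (ler_norm _))// normrN lerDr.
have : e = delta + delta by rewrite -splitr.
lra.
Qed.

End xlnx.

(** * Pressure and equilibrium states *)

Section thermodynamics.
Context {T : ptopologicalType} {R : realType} {K I : finType}.
Hypothesis compactT : compact [set: T].
Variables (g : T -> T) (P : T -> I) (u : K -> T -> R) (r : nat -> R).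
Variable o : K -> I -> bool.
Hypothesis cg : continuous g.
Hypothesis oP : open_label P.
Hypothesis cu : forall k, continuous (u k).
Hypothesis open_gen : @open T `<=`
  <<s [set A | exists k i, A = [set x | r i < u k x] ] >>.
Hypothesis mono : forall k x y, P x = P y -> u k x <= u k y ->
  if o k (P x) then u k (g y) <= u k (g x) else u k (g x) <= u k (g y).

Definition invariant (eta : probability (borel T) R) :=
  invariant_measure eta g.

Definition measure_entropy (eta : probability (borel T) R) : R :=
  fine (metric_entropy eta g).

Lemma borel_gen : @measurable _ (borel T) `<=`
  <<s [set A | exists k i, A = [set x | r i < u k x] ] >>.
Proof. apply: smallest_sub open_gen; exact: smallest_sigma_algebra. Qed.

Lemma measure_entropyP (eta : probability (borel T) R) : invariant eta ->
  [/\ metric_entropy eta g = (measure_entropy eta)%:E,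
  (fun n => entropy eta (itinerary g P n) / n%:R) @ \oo --> measure_entropy eta &
  forall n, (0 < n)%N -> measure_entropy eta <= entropy eta (itinerary g P n) / n%:R].
Proof.
move=> inv; have mP := open_label_measurable oP.
have mu_ k a : measurable ([set x | a < u k x] : set (borel T)).
  apply: open_borel; apply: (@open_comp _ _ (u k) [set y | a < y]).
    by move=> x _; exact: cu.
  exact: open_gt.
have [h [hE]] := metric_entropy_coding (borel_preimage cg) inv mP mu_ mono borel_gen.
by rewrite /measure_entropy hE.
Qed.

Lemma measure_entropy_le (eta : probability (borel T) R) :
  invariant eta -> measure_entropy eta <= ln #|{ffun 'I_1 -> I}|%:R.
Proof.
move=> inv; have [_ _ /(_ 1%N isT)] := measure_entropyP inv.
rewrite divr1 => /le_trans; apply; apply: entropy_le_card.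
apply: measurable_itinerary; first exact: borel_preimage.
exact: open_label_measurable.
Qed.

Lemma pressureE (eta : probability (borel T) R) (phi : T -> R) :
  invariant eta -> continuous phi ->
  pressure eta g phi = (measure_entropy eta + mean eta phi)%:E.
Proof.
move=> inv cphi; have [hE _ _] := measure_entropyP inv.
by rewrite /pressure hE (meanE compactT)// -EFinD.
Qed.

Variable eta0 : probability (borel T) R.
Hypothesis inv0 : invariant eta0.

Definition top_pressure (phi : T -> R) : R :=
  sup [set measure_entropy eta + mean eta phi | eta in invariant].

Lemma has_sup_pressure (phi : T -> R) : continuous phi ->
  has_sup [set measure_entropy eta + mean eta phi | eta in invariant].
Proof.
move=> cphi; split.
  by exists (measure_entropy eta0 + mean eta0 phi), eta0.
have [M _ phiM] := continuous_compact_bounded compactT cphi.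
exists (ln #|{ffun 'I_1 -> I}|%:R + M) => _ [eta inv <-].
rewrite lerD ?measure_entropy_le// -(mean_cst eta M); apply: mean_le => //.
  exact: continuous_cst.
by move=> x; exact: le_trans (ler_norm _) (phiM x).
Qed.

Lemma top_pressure_ge (eta : probability (borel T) R) (phi : T -> R) :
  continuous phi -> invariant eta ->
  measure_entropy eta + mean eta phi <= top_pressure phi.
Proof.
by move=> cphi inv; apply: ub_le_sup; [case: (has_sup_pressure cphi)|exists eta].
Qed.

(** Cylinders of [P] are clopen, so their masses are means of continuous functions and pass to the
    weak limit. *)
Lemma entropy_itinerary_lim (U : set_system nat)
    (eta : nat -> probability (borel T) R) (mu : probability (borel T) R) k :
  ProperFilter U ->
  (forall f : T -> R, continuous f -> (fun n => mean (eta n) f) @ U --> mean mu f) ->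
  (fun n => entropy (eta n) (itinerary g P k)) @ U --> entropy mu (itinerary g P k).
Proof.
move=> UU etamu; rewrite /entropy.
have oit := @open_label_itinerary _ _ _ _ k cg oP.
apply: cvgN; apply: cvg_big => [|w _]; first exact: add_continuous.
have m01 n : 0 <= mass (eta n) (itinerary g P k) w <= 1.
  rewrite mass_ge0 -(sum_mass (eta n) (open_label_measurable oit)) (bigD1 w)//= lerDl.
  by apply: sumr_ge0 => v _; exact: mass_ge0.
apply: (cvg_xlnx _ m01); rewrite mass_mean//.
under eq_fun do rewrite mass_mean//.
apply: etamu.
exact: (@open_label_continuous T R _ _ (fun v => (v == w)%:R) oit).
Qed.

(** The limit measure and its image under [g] have the same means on all bumps. *)
Lemma weak_limit_invariant (U : set_system nat)
    (eta : nat -> probability (borel T) R) (mu : probability (borel T) R) :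
  ProperFilter U -> (forall n, invariant (eta n)) ->
  (forall f : T -> R, continuous f -> (fun n => mean (eta n) f) @ U --> mean mu f) ->
  invariant mu.
Proof.
move=> UU inv etamu.
have meang (f : T -> R) : continuous f -> mean mu (f \o g) = mean mu f.
  move=> cf; have cfg : continuous (f \o g).
    by move=> x; apply: continuous_comp; [exact: cg|exact: cf].
  have e : (fun n => mean (eta n) (f \o g)) = (fun n => mean (eta n) f).
    by apply/funext => n; exact: (mean_invariant compactT cg (inv n) cf).
  have c1 := etamu _ cfg; rewrite e in c1.
  apply: etrans (_ : lim (mean (eta n) f @[n --> U]) = _); first exact/esym/cvg_lim.
  by apply/cvg_lim => //; exact: etamu.
have [nu [nuE nuf]] := continuous_image compactT cg mu.
move=> A mA; apply: etrans (esym (nuE A)) _.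
apply: (eq_measure_mean compactT cu open_gen) => // l j.
by rewrite nuf ?meang//; exact: continuous_bump.
Qed.

(** For fixed k, the pressure of [eta n] is at most its rate at time k plus its mean of [phi].
    Letting n tend to infinity along U gives the same bound with the limit measure, and then k tends
    to infinity. *)
Lemma top_pressure_attained (phi : T -> R) : continuous phi ->
  exists2 eta, invariant eta & measure_entropy eta + mean eta phi = top_pressure phi.
Proof.
move=> cphi; have hs := has_sup_pressure cphi.
have /choice[eta etaP] : forall n : nat, exists eta, invariant eta /\
    top_pressure phi - n.+1%:R^-1 < measure_entropy eta + mean eta phi.
  move=> n; have n0 : 0 < n.+1%:R^-1 :> R by rewrite invr_gt0.
  by have [_ [eta inv <-] lt] := sup_adherent n0 hs; exists eta.
(* [U] refines [\oo], so ordinary limits of sequences, such as that of 1 / (n + 1), remain limits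
   along [U]. *)
have [U [UU oU]] := @ultraFilterLemma nat \oo _.
have UF : ProperFilter U by exact: ultra_proper.
have open_cozero : @open T `<=`
    <<s [set A | exists2 v : T -> R, continuous v & A = [set x | 0 < v x] ] >>.
  move=> A /open_gen; apply: smallest_sub A; first exact: smallest_sigma_algebra.
  move=> _ [k [i ->]]; apply: sub_sigma_algebra; exists (fun x => u k x - r i).
    by apply: continuous_sub => //; exact: continuous_cst.
  by apply/seteqP; split=> x /=; rewrite subr_gt0.
have [mu etamu] := weak_limit compactT open_cozero eta UU.
have invmu : invariant mu by apply: weak_limit_invariant etamu => n; case: (etaP n).
exists mu => //; apply/eqP; rewrite eq_le top_pressure_ge//=.
have [_ cv _] := measure_entropyP invmu.
suff H k : (0 < k)%N -> top_pressure phi <= entropy mu (itinerary g P k) / k%:R + mean mu phi.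
  apply: (cvgr_to_ge (cvgD cv (cvg_cst (mean mu phi)))).
  by exists 1%N => // k /= /H.
move=> k0.
have c1 : (fun n => top_pressure phi - n.+1%:R^-1) @ U --> top_pressure phi - 0.
  apply: cvgB; first exact: cvg_cst.
  by apply: cvg_trans cvg_harmonic; exact: cvg_app.
have c2 : (fun n => entropy (eta n) (itinerary g P k) / k%:R + mean (eta n) phi) @ U
    --> entropy mu (itinerary g P k) / k%:R + mean mu phi.
  apply: cvgD; last exact: etamu.
  by apply: cvgM; [exact: entropy_itinerary_lim|exact: cvg_cst].
rewrite -[leLHS]subr0; apply: (ler_cvg_to c1 c2); apply: nearW => n.
have [invn lt] := etaP n; apply: le_trans (ltW lt) _.
by rewrite lerD2r; have [_ _ ->] := measure_entropyP invn.
Qed.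

Definition equilibrium (phi : T -> R) (eta : probability (borel T) R) :=
  invariant eta /\ forall eta' : probability (borel T) R, invariant eta' ->
    (pressure eta' g phi <= pressure eta g phi)%E.

Lemma equilibriumP (phi : T -> R) eta : continuous phi ->
  equilibrium phi eta <->
  invariant eta /\ measure_entropy eta + mean eta phi = top_pressure phi.
Proof.
move=> cphi; split=> -[inv eta_max]; split=> //.
  apply/eqP; rewrite eq_le top_pressure_ge//=.
  have [mu invmu <-] := top_pressure_attained cphi.
  by have := eta_max _ invmu; rewrite !pressureE// lee_fin.
move=> eta' inv'; rewrite !pressureE// lee_fin eta_max.
exact: top_pressure_ge.
Qed.

Lemma equilibrium_exists (phi : T -> R) : continuous phi ->
  exists eta, equilibrium phi eta.
Proof.
move=> cphi; have [eta inv eq] := top_pressure_attained cphi.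
by exists eta; apply/equilibriumP.
Qed.

Lemma top_pressure_lip (phi psi : T -> R) e : continuous phi -> continuous psi ->
  (forall x, `|phi x - psi x| <= e) -> top_pressure phi <= top_pressure psi + e.
Proof.
move=> cphi cpsi h; have [eta inv <-] := top_pressure_attained cphi.
have := mean_dist compactT eta cphi cpsi h; rewrite ler_distl => /andP[_ h'].
have := top_pressure_ge cpsi inv; lra.
Qed.

(** * Uniqueness for generic potentials *)

Definition second_difference (psi phi : T -> R) (t : R) : R :=
  top_pressure (fun x => phi x + t * psi x)
  + top_pressure (fun x => phi x + - t * psi x) - 2 * top_pressure phi.

Definition nearly_differentiable (psi : T -> R) (eps : R) (phi : T -> R) :=
  exists2 t, 0 < t & second_difference psi phi t < eps * t.

(** Test [eta] against phi + t psi and [eta'] against phi - t psi. In the sum, the entropies and the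
    means of phi make up twice the top pressure of phi, which leaves t times the difference of the
    means of psi. *)
Lemma nearly_differentiable_mean (psi phi : T -> R) (eps : R) eta eta' :
  continuous psi -> continuous phi -> nearly_differentiable psi eps phi ->
  equilibrium phi eta -> equilibrium phi eta' ->
  mean eta psi - mean eta' psi <= eps.
Proof.
move=> cpsi cphi [t t0 ht] /(equilibriumP _ cphi)[inv e1] /(equilibriumP _ cphi)[inv' e2].
have c1 s : continuous (fun x => s * psi x) by exact: continuous_scale.
have c2 s : continuous (fun x => phi x + s * psi x) by exact: continuous_add.
have := top_pressure_ge (c2 t) inv; have := top_pressure_ge (c2 (- t)) inv'.
rewrite !(meanD compactT)// !(meanZ compactT)// => h1 h2.
rewrite -(ler_pM2r t0); move: ht; rewrite /second_difference; lra.
Qed.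

Lemma nearly_differentiable_open (psi phi : T -> R) (eps : R) :
  continuous psi -> continuous phi -> nearly_differentiable psi eps phi ->
  exists2 e, 0 < e & forall phi' : T -> R, continuous phi' ->
    (forall x, `|phi x - phi' x| <= e) -> nearly_differentiable psi eps phi'.
Proof.
move=> cpsi cphi [t t0 ht]; pose s := eps * t - second_difference psi phi t.
have s0 : 0 < s by rewrite subr_gt0.
(* Three pressures enter with coefficients 1, 1 and 2, so the second difference moves by at most 4 s
   / 5 < s. *)
exists (s / 5) => [|phi' cphi' h]; first by rewrite divr_gt0.
exists t => //; have c1 a : continuous (fun x => a * psi x) by exact: continuous_scale.
have c2 a : continuous (fun x => phi x + a * psi x) by exact: continuous_add.
have c3 a : continuous (fun x => phi' x + a * psi x) by exact: continuous_add.
have h1 a : top_pressure (fun x => phi' x + a * psi x) <=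
    top_pressure (fun x => phi x + a * psi x) + s / 5.
  apply: top_pressure_lip => // x.
  by rewrite opprD addrACA subrr addr0 distrC.
have h2 := top_pressure_lip cphi cphi' h.
have := h1 t; have := h1 (- t).
have : eps * t = s + second_difference psi phi t by rewrite /s subrK.
rewrite /second_difference; lra.
Qed.

(* Otherwise the increments of s |-> P(phi + s psi) along an arithmetic
   progression would grow by a fixed amount at each of its terms, contradicting
   the Lipschitz bound on the increments. *)
Lemma nearly_differentiable_dense (psi phi : T -> R) (eps delta : R) :
  continuous psi -> (forall x, 0 <= psi x <= 1) -> continuous phi ->
  0 < eps -> 0 < delta ->
  exists s, 0 <= s < delta /\ nearly_differentiable psi eps (fun x => phi x + s * psi x).
Proof.
move=> cpsi psi01 cphi eps0 delta0; apply: contrapT => /forallNP H.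
(* The increments over a step h lie in [-h,h]. Growth by eps h at each of N steps is impossible as
   soon as N eps > 2. Dividing [delta] by N + 1 below keeps all the centres i h with i <= N under
   [delta]. *)
pose N := (Num.truncn (2 / eps)).+1.
have Neps : 2 < N%:R * eps by rewrite -ltr_pdivrMr// truncnS_gt.
pose h := delta / N.+1%:R.
have h0 : 0 < h by rewrite divr_gt0.
pose q (i : nat) := top_pressure (fun x => phi x + (i%:R * h) * psi x).
have cc a : continuous (fun x => phi x + a * psi x).
  by apply: continuous_add => //; exact: continuous_scale.
have lip a b : `|a - b| <= h -> top_pressure (fun x => phi x + a * psi x) <=
    top_pressure (fun x => phi x + b * psi x) + h.
  move=> ab; apply: top_pressure_lip => // x.
  rewrite opprD addrACA subrr add0r -mulrBl normrM -[leRHS]mulr1.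
  have /andP[p0 p1] := psi01 x.
  by rewrite ler_pM// ger0_norm.
have step i : (i.+1 <= N)%N -> eps * h <= q i.+2 + q i - 2 * q i.+1.
  move=> iN; rewrite leNgt; apply/negP => lt.
  apply: (H (i.+1%:R * h)); split.
    rewrite mulr_ge0 ?(ltW h0)//= /h mulrCA -ltr_pdivlMl// mulVf ?gt_eqF//.
    by rewrite ltr_pdivrMr// mul1r ltr_nat.
  exists h => //; apply: le_lt_trans lt; rewrite /second_difference /q.
  rewrite le_eqVlt; apply/orP; left; apply/eqP; congr (_ + _ - _).
    by congr top_pressure; apply/funext => x; rewrite -[i.+2%:R]natr1; ring.
  by congr top_pressure; apply/funext => x; rewrite -[i.+1%:R]natr1; ring.
have grow i : (i <= N)%N -> i%:R * (eps * h) - h <= q i.+1 - q i.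
  elim: i => [_|i IH iN].
    rewrite mul0r sub0r /q; have := lip (0%:R * h) (1%:R * h).
    by rewrite mul0r sub0r normrN mul1r gtr0_norm// => /(_ (lexx _)); lra.
  have := IH (ltnW iN); have := step i iN.
  by rewrite -[i.+1%:R]natr1 mulrDl mul1r; lra.
have := grow N (leqnn N).
have := lip (N.+1%:R * h) (N%:R * h).
rewrite -mulrBl -[N.+1%:R]natr1 addrAC subrr add0r mul1r gtr0_norm// => /(_ (lexx _)).
rewrite natr1 -/(q N) -/(q N.+1) => h1 h2.
have : 2 * h < N%:R * eps * h by rewrite ltr_pM2r.
lra.
Qed.

Lemma bump01 l j x : 0 <= bump u r l j x <= 1.
Proof. by rewrite bump_ge0 bump_le1. Qed.

Lemma residual_unique_equilibrium :
  exists G : set (C0 T R), residual G /\ forall phi : C0 T R, G phi ->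
    exists eta, equilibrium (C0_fun phi) eta /\
      forall eta', equilibrium (C0_fun phi) eta' ->
        forall A : set (borel T), measurable A -> eta' A = eta A.
Proof.
pose V (p : seq (K * nat) * nat * nat) : set (C0 T R) :=
  [set phi | nearly_differentiable (bump u r p.1.1 p.1.2) p.2.+1%:R^-1 (C0_fun phi)].
(* One condition for each bump (l, j) and each precision 1 / (m + 1), enumerated by [pickle];
   indices that decode to nothing impose no condition. *)
pose U (n : nat) := if unpickle n is Some p then V p else setT.
have cC0 (phi : C0 T R) : continuous (C0_fun phi) by exact: cts_fun.
have cb l j : continuous (bump u r l j) by exact: continuous_bump.
exists (\bigcap_n U n); split.
  exists U; split=> // n; rewrite /U; case: (unpickle n) => [[[l j] m]|]; last first.
    by split; [exact: openT|move=> O [x Ox] _; exists x].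
  have m0 : 0 < m.+1%:R^-1 :> R by rewrite invr_gt0.
  split.
    rewrite openE => phi Vphi; rewrite /interior -nbhs_ballE.
    have [e e0 He] := nearly_differentiable_open (cb l j) (cC0 phi) Vphi.
    exists e => // phi' /C0_ballE B; apply: He => // x.
    exact: ltW.
  move=> O [phi Ophi]; rewrite openE => /(_ _ Ophi); rewrite /interior -nbhs_ballE.
  move=> [e /= e0 Be].
  have [s [/andP[s0 se] Hs]] :=
    nearly_differentiable_dense (cb l j) (bump01 l j) (cC0 phi) m0 e0.
  have cs : continuous (fun x => C0_fun phi x + s * bump u r l j x).
    by apply: continuous_add => //; exact: continuous_scale.
  exists (mkcts cs : C0 T R); split; last exact: Hs.
  apply: Be; apply/C0_ballE => x.
  rewrite /C0_fun /= opprD addrA subrr add0r normrN ger0_norm; last first.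
    by rewrite mulr_ge0// bump_ge0.
  by apply: le_lt_trans se; rewrite ler_piMr// bump_le1.
move=> phi Gphi; have [eta eq_eta] := equilibrium_exists (cC0 phi).
exists eta; split=> // eta' eq_eta' A mA; apply: (eq_measure_mean compactT cu open_gen) => // l j.
have near_diff m : nearly_differentiable (bump u r l j) m.+1%:R^-1 (C0_fun phi).
  have := Gphi (pickle (l, j, m)) Logic.I; rewrite /U pickleK.
  exact.
have le e1 e2 : equilibrium (C0_fun phi) e1 -> equilibrium (C0_fun phi) e2 ->
    mean e1 (bump u r l j) <= mean e2 (bump u r l j).
  move=> q1 q2; apply/ler_addgt0Pr => e e0.
  (* The index m = truncn (1 / e) is chosen so that 1 / (m + 1) <= e. *)
  rewrite -lerBlDl; apply: le_trans (nearly_differentiable_mean (cb l j) (cC0 phi)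
    (near_diff (Num.truncn e^-1)) q1 q2) _.
  by rewrite invf_ple ?posrE// ltW// truncnS_gt.
by apply/eqP; rewrite eq_le !le.
Qed.

End thermodynamics.

(** * The horseshoe *)

(** Every rational occurs as a threshold; indices that decode to nothing give 0. *)
Definition rational_enum {R : realType} (i : nat) : R :=
  ratr (odflt (0 : rat) (unpickle i)).

Lemma rational_enum_itv {R : realType} (a b : R) : a < b ->
  exists i, a < rational_enum i < b.
Proof.
move=> /rat_in_itvoo[q]; rewrite in_itv/= => qab.
by exists (pickle q); rewrite /rational_enum pickleK.
Qed.

(** An open set is a countable union of boxes with rational sides. The boxes are half-open because
    they are cut out of the sets {q < u k} by differences. *)
Lemma open_sub_sigma_coordinates {T : ptopologicalType} {R : realType} {K : finType}
    (u : K -> T -> R) :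
  (forall (O : set T) a, open O -> O a -> exists2 e, 0 < e &
     forall b, (forall k, `|u k a - u k b| < e) -> O b) ->
  @open T `<=`
    <<s [set A | exists k i, A = [set x | rational_enum i < u k x] ] >>.
Proof.
move=> openu O oO; set G := (X in <<s X >>).
pose S := g_sigma_algebraType G.
have mG k i : measurable ([set x | rational_enum i < u k x] : set S).
  by apply: sub_sigma_algebra; exists k, i.
pose B (f : {ffun K -> nat * nat}) : set S := \bigcap_(k in [set: K])
  ([set x | rational_enum (f k).1 < u k x] `\`
   [set x | rational_enum (f k).2 < u k x]).
have mB f : measurable (B f).
  by apply: fin_bigcap_measurable => // k _; exact: measurableD.
suff -> : O = \bigcup_(f in [set: {ffun K -> nat * nat}])
    (if `[< B f `<=` O >] then B f else set0) :> set S.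
  apply: (@countable_bigcupT_measurable _ S) => // f; by case: ifP.
apply/seteqP; split=> [a Oa|a [f _]]; last by case: asboolP => [BO|_ []//]; exact: BO.
have [e e0 He] := openu O a oO Oa.
have /choice[f Hf] : forall k, exists ij : nat * nat,
    u k a - e / 2 < rational_enum ij.1 < u k a /\
    u k a < rational_enum ij.2 < u k a + e / 2.
  move=> k; have [i Hi] : exists i, u k a - e / 2 < rational_enum i < u k a.
    by apply: rational_enum_itv; lra.
  have [j Hj] : exists j, u k a < rational_enum j < u k a + e / 2.
    by apply: rational_enum_itv; lra.
  by exists (i, j).
exists [ffun k => f k] => //; case: asboolP => [_|[]].
  move=> k _ /=; rewrite ffunE; have [/andP[_ h1] /andP[h2 _]] := Hf k.
  by split=> //; apply/negP; rewrite -leNgt ltW.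
move=> b Bb; apply: He => k; have [/andP[h1 h2] /andP[h3 h4]] := Hf k.
have := Bb k Logic.I; rewrite ffunE /= => -[h5 /negP]; rewrite -leNgt => h6.
by rewrite ltr_norml; apply/andP; split; lra.
Qed.

(** * Continuity of F on Lambda and compactness of Lambda *)

Section horseshoe_set.
Context {R : realType}.
Variable p : params R.

Definition coord (k : 'I_3) (a : R * R * R) : R :=
  match val k with 0%N => a.1.1 | 1%N => a.1.2 | _ => a.2 end.

Lemma coord_dist (a b : R * R * R) e :
  (forall k, `|coord k a - coord k b| < e) -> ball a e b.
Proof.
move=> H; split; first split.
- exact: (H (@Ordinal 3 0 isT)).
- exact: (H (@Ordinal 3 1 isT)).
- exact: (H (@Ordinal 3 2 isT)).
Qed.

Lemma continuous_coord k : continuous (coord k).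
Proof.
move=> a; rewrite /coord; case: (val k) => [|[|n]].
- by apply: cvg_comp; [exact: cvg_fst|exact: cvg_fst].
- by apply: cvg_comp; [exact: cvg_fst|exact: cvg_snd].
- exact: cvg_snd.
Qed.

Lemma continuous_Lam_val : continuous (@Lam_val R p).
Proof.
move=> a; apply/(@cvg_ballP _ _ _ (nbhs a) (nbhs_filter a)) => e e0.
exact: (nbhsx_ballx a e e0).
Qed.

Lemma Lam_open_coord (O : set (Lam p)) a : open O -> O a ->
  exists2 e, 0 < e & forall b,
    (forall k, `|coord k (Lam_val a) - coord k (Lam_val b)| < e) -> O b.
Proof.
move=> oO Oa; have : nbhs a O by exact: open_nbhs_nbhs.
rewrite -nbhs_ballE => -[e /= e0 BO]; exists e => // b /coord_dist.
exact: BO.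
Qed.

Definition branch0 (a : R * R * R) : R * R * R :=
  (lambda0 p * a.1.1, flow1 a.1.2, beta0 p * a.2).

Definition branch1 (a : R * R * R) : R * R * R :=
  (3 / 4 - lambda1 p * a.1.1, sigma p * (1 - a.1.2), beta1 p * (a.2 - 5 / 6)).

Lemma Fmap0 a : R0 a -> Fmap p a = branch0 a.
Proof. by case: a => -[x y] z Ra; rewrite /Fmap mem_set. Qed.

Lemma R0_lt a : (@R0 R `|` @R1 R) a -> R0 a <-> a.2 < 1 / 2.
Proof.
by move=> [|] Ra; have [x01 y01 /andP[z0 z1]] := Ra; split=> //;
  [move=> _; lra|move=> [_ _ /andP[_ z2]]; lra|lra].
Qed.

Lemma Fmap1 a : R1 a -> Fmap p a = branch1 a.
Proof.
case: a => -[x y] z Ra; rewrite /Fmap memNset//.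
move=> /(R0_lt (or_intror Ra)) /=; have [_ _ /= /andP[z0 _]] := Ra; lra.
Qed.

Lemma flow1_den_gt0 (y : R) : 0 <= y <= 1 -> 0 < y + (1 - y) * expR (- 1).
Proof.
move=> /andP[y0 y1]; have e0 := @expR_gt0 R (-1).
have [y_lt|y_ge] := ltP y (1 / 2).
  by apply: ltr_wpDl => //; apply: mulr_gt0 => //; lra.
by apply: ltr_pwDl; [lra|apply: mulr_ge0; lra].
Qed.

Lemma le_flow1 (y y' : R) : 0 <= y <= 1 -> 0 <= y' <= 1 -> y <= y' ->
  flow1 y <= flow1 y'.
Proof.
move=> y01 y'01 yy'; have e0 := @expR_gt0 R (-1).
rewrite /flow1 ler_pdivrMr ?flow1_den_gt0// mulrAC ler_pdivlMr ?flow1_den_gt0//.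
(* After cross-multiplication the terms in y y' cancel. *)
rewrite -subr_ge0 (_ : _ - _ = (y' - y) * expR (-1)); last by ring.
by apply: mulr_ge0; lra.
Qed.

Section cvg_maps.
Context {I : Type} {F : set_system I} {FF : Filter F}.
Variables (a : I -> R * R * R) (l : R * R * R).
Hypothesis al : a @ F --> l.

Lemma cvg_coord k : (fun n => coord k (a n)) @ F --> coord k l.
Proof. by apply: continuous_cvg => //; exact: continuous_coord. Qed.

Lemma cvg_branch0 : 0 <= l.1.2 <= 1 -> (fun n => branch0 (a n)) @ F --> branch0 l.
Proof.
move=> y01.
have cx := @cvg_coord (@Ordinal 3 0 isT); have cy := @cvg_coord (@Ordinal 3 1 isT).
have cz := @cvg_coord (@Ordinal 3 2 isT); rewrite /coord/= in cx cy cz.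
apply: (@cvg_pair _ _ _ F (nbhs _) (nbhs _)); first apply: (@cvg_pair _ _ _ F (nbhs _) (nbhs _)).
- by apply: cvgM => //; exact: cvg_cst.
- apply: cvgM => //; apply: cvgV; first by rewrite gt_eqF// flow1_den_gt0.
  apply: cvgD => //; apply: cvgM; last exact: cvg_cst.
  by apply: cvgB => //; exact: cvg_cst.
- by apply: cvgM => //; exact: cvg_cst.
Qed.

Lemma cvg_branch1 : (fun n => branch1 (a n)) @ F --> branch1 l.
Proof.
have cx := @cvg_coord (@Ordinal 3 0 isT); have cy := @cvg_coord (@Ordinal 3 1 isT).
have cz := @cvg_coord (@Ordinal 3 2 isT); rewrite /coord/= in cx cy cz.
apply: (@cvg_pair _ _ _ F (nbhs _) (nbhs _)); first apply: (@cvg_pair _ _ _ F (nbhs _) (nbhs _)).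
- apply: cvgB; first exact: cvg_cst.
  by apply: cvgM => //; exact: cvg_cst.
- apply: cvgM; first exact: cvg_cst.
  by apply: cvgB => //; exact: cvg_cst.
- apply: cvgM; first exact: cvg_cst.
  by apply: cvgB => //; exact: cvg_cst.
Qed.

(** Height 1/2 separates the two pieces, so eventually [a n] lies in the piece of its limit and one
    branch formula applies. A general filter serves both the continuity of [FL] and the ultrafilter
    limits of orbits. *)
Lemma cvg_Fmap : (forall n, (@R0 R `|` @R1 R) (a n)) -> (@R0 R `|` @R1 R) l ->
  (fun n => Fmap p (a n)) @ F --> Fmap p l.
Proof.
move=> aX lX; have cz := @cvg_coord (@Ordinal 3 2 isT); rewrite /coord/= in cz.
case: (lX) => [l0|l1].
  rewrite Fmap0//; have [_ y01 _] := l0.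
  apply: cvg_trans (cvg_branch0 y01); apply: near_eq_cvg.
  have : l.2 < 1 / 2 by apply/R0_lt.
  move=> /(cvgr_lt _ cz); apply: filterS => n an.
  by rewrite Fmap0//; apply/R0_lt.
rewrite Fmap1//; apply: cvg_trans cvg_branch1; apply: near_eq_cvg.
have : 1 / 2 < l.2 by have [_ _ /andP[z0 _]] := l1; lra.
move=> /(cvgr_gt _ cz); apply: filterS => n an.
rewrite Fmap1//; case: (aX n) => // /(R0_lt (aX n)) h.
by have := lt_trans an h; rewrite ltxx.
Qed.

End cvg_maps.

Lemma Lambda_sub a : Lambda p a -> (@R0 R `|` @R1 R) a.
Proof. by move=> [orb [<- + _]]; exact. Qed.

Lemma Lam_valP (a : Lam p) : Lambda p (Lam_val a).
Proof. exact: set_valP. Qed.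

Lemma continuous_FL : continuous (@FL R p).
Proof.
move=> a; apply/(@cvg_ballP _ _ _ (nbhs a) (nbhs_filter a)) => e e0.
have := @cvg_Fmap _ (nbhs a) (nbhs_filter a) (@Lam_val R p) (Lam_val a) (@continuous_Lam_val a).
move=> /(_ (fun n => Lambda_sub (Lam_valP n)) (Lambda_sub (Lam_valP a))).
by move=> /(@cvg_ballP _ _ _ (nbhs a) (nbhs_filter a))/(_ _ e0).
Qed.

Lemma compact_R01 : compact (@R0 R `|` @R1 R).
Proof.
apply: compactU.
  rewrite (_ : R0 = (`[0, 1] `*` `[0, 1]) `*` `[0, 1 / 6])%classic.
    by apply: compact_setX; [apply: compact_setX|]; exact: segment_compact.
  by apply/seteqP; split=> -[[x y] z]; rewrite /R0/= !in_itv/=; [move=> []|move=> [[]]].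
rewrite (_ : R1 = (`[0, 1] `*` `[0, 1]) `*` `[5 / 6, 1])%classic.
  by apply: compact_setX; [apply: compact_setX|]; exact: segment_compact.
by apply/seteqP; split=> -[[x y] z]; rewrite /R1/= !in_itv/=; [move=> []|move=> [[]]].
Qed.

(* An ultrafilter on Lambda converges along every coordinate of the orbits, and
   the limits form an orbit because F is continuous on R0 `|` R1. *)
Lemma compact_Lam : compact [set: Lam p].
Proof.
rewrite compact_ultra => U UU _.
have UF : ProperFilter U by exact: ultra_proper.
have /choice[orb orbP] : forall a : Lam p, exists orb : int -> R * R * R,
    [/\ orb 0 = Lam_val a, forall n, (R0 `|` R1) (orb n) &
        forall n, Fmap p (orb n) = orb (n + 1)].
  by move=> a; exact: Lam_valP.
have orbX a n : (R0 `|` R1) (orb a n) by have [_ + _] := orbP a; exact.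
have /choice[l lP] : forall n : int, exists ln, (R0 `|` R1) ln /\
    (fun a => orb a n) @ U --> ln.
  move=> n; have [ln] := compact_ultra_cvg compact_R01 UU (fun a => orbX a n).
  by exists ln.
have lF n : Fmap p (l n) = l (n + 1).
  have [lX cl] := lP n; have [_ cl1] := lP (n + 1).
  have := cvg_Fmap cl (fun a => orbX a n) lX.
  rewrite (_ : (fun a => Fmap p (orb a n)) = (fun a => orb a (n + 1))).
    move=> h; have FU : ProperFilter ((fun a => orb a (n + 1)) @ U) by exact: fmap_proper_filter.
    have HH : hausdorff_space (R * R * R)%type by exact: norm_hausdorff.
    exact: (@cvg_unique _ HH _ FU _ _ (h _) cl1).
  by apply/funext => a; have [_ _ ->] := orbP a.
have L0 : Lambda p (l 0) by exists l; split=> // n; case: (lP n).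
pose b : Lam p := exist _ (l 0) (mem_set L0).
exists b; split=> //; rewrite /=.
have [_ /cvg_ballP H] := lP 0.
suff : id @ U --> b by [].
apply/cvg_ballP => e e0; apply: filterS (H e e0) => a.
by have [-> _ _] := orbP a.
Qed.

End horseshoe_set.

(** * Monotone branches and an invariant measure *)

Section horseshoe_dynamics.
Context {R : realType}.
Variable p : params R.
Hypothesis hlambda0 : 0 < lambda0 p.
Hypothesis hbeta0 : 0 < beta0 p.
Hypothesis hlambda1 : 0 < lambda1 p.
Hypothesis hsigma : 0 < sigma p.
Hypothesis hbeta1 : 0 < beta1 p.

(* Any threshold between 1/6 and 5/6 separates R0 from R1. *)
Definition lower_piece (a : Lam p) : bool := (Lam_val a).2 < 1 / 2.

(** On R1 the slopes are -lambda1, -sigma and beta1, so x and y are reversed and z is not; on R0 all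
    three coordinates are increasing. *)
Definition reversing (k : 'I_3) (lower : bool) : bool := ~~ lower && (k < 2)%N.

Definition Lam_coord (k : 'I_3) (a : Lam p) : R := coord k (Lam_val a).

Lemma continuous_Lam_coord k : continuous (Lam_coord k).
Proof.
move=> a; apply: continuous_comp; first exact: continuous_Lam_val.
exact: continuous_coord.
Qed.

Lemma lower_pieceP a : if lower_piece a then R0 (Lam_val a) else R1 (Lam_val a).
Proof.
rewrite /lower_piece; have aX := Lambda_sub (Lam_valP a).
case: ifPn => [/(R0_lt aX)//|/negP h].
by case: (aX) => // /(R0_lt aX).
Qed.

Lemma open_lower_piece : open_label lower_piece.
Proof.
have cz := @continuous_Lam_coord (@Ordinal 3 2 isT); rewrite /Lam_coord /coord/= in cz.
case.
  by apply: (open_comp (f := fun a : Lam p => (Lam_val a).2) (D := [set y | y < 1 / 2]))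
    => [a _|]; [exact: cz|exact: open_lt].
rewrite (_ : _ @^-1` _ = (fun a : Lam p => (Lam_val a).2) @^-1` [set y | 1 / 2 < y]).
  by apply: open_comp => [a _|]; [exact: cz|exact: open_gt].
apply/seteqP; split=> a /=; have := lower_pieceP a; rewrite /lower_piece.
  by case: ifP => // _ [_ _ /andP[z0 z1]] _; lra.
by move=> _ h; apply/negbTE; rewrite -leNgt ltW.
Qed.

(** On each piece F is a product of three interval maps, so every coordinate of the image depends
    monotonically on the same coordinate of the point. *)
Lemma FL_monotone k (a b : Lam p) : lower_piece a = lower_piece b ->
  Lam_coord k a <= Lam_coord k b ->
  if reversing k (lower_piece a) then Lam_coord k (FL b) <= Lam_coord k (FL a)
  else Lam_coord k (FL a) <= Lam_coord k (FL b).
Proof.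
move=> ab; have := lower_pieceP b; have := lower_pieceP a; rewrite -ab.
rewrite /Lam_coord -[Lam_val (FL a)]/(Fmap p (Lam_val a)).
rewrite -[Lam_val (FL b)]/(Fmap p (Lam_val b)).
case: lower_piece => Ra Rb.
  rewrite !Fmap0// /reversing/= /coord; have [_ ya _] := Ra; have [_ yb _] := Rb.
  case: (val k) => [|[|n]] /= h; first by rewrite ler_pM2l.
    exact: le_flow1.
  by rewrite ler_pM2l.
rewrite !Fmap1// /reversing/= /coord.
case: k => [[|[|[|//]]] ?] /= h.
- by rewrite lerD2l lerN2 ler_pM2l.
- by rewrite ler_pM2l// lerD2l lerN2.
- by rewrite ler_pM2l// lerD2r.
Qed.

(* The distinguished point of [Lam p] is (0, 0, 0). *)
Definition origin : Lam p := point.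

Lemma FL_origin : FL origin = origin.
Proof.
apply: val_inj; rewrite /= /Fmap mem_set; last first.
  by split; rewrite /= ?lexx ?ler01 ?divr_ge0.
by rewrite /flow1 !mulr0 mul0r.
Qed.

(** Provides an invariant probability, so that the supremum defining the top pressure is taken over
    a nonempty set. *)
Lemma dirac_origin_invariant :
  invariant_measure (@dirac _ (borel (Lam p)) origin R) (@FL R p).
Proof.
move=> A _; apply: etrans (diracE _ _ _) (etrans _ (esym (diracE _ _ _))).
congr (nat_of_bool _)%:R%:E.
by apply/idP/idP => /set_mem h; apply/mem_set; move: h; rewrite /= FL_origin.
Qed.

Lemma continuous_restriction (phi : R * R * R -> R) :
  {within cube, continuous phi} -> continuous (fun a : Lam p => phi (Lam_val a)).
Proof.
move=> /subspace_continuousP cphi a.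
have sub (b : Lam p) : cube (Lam_val b).
  by case: (Lambda_sub (Lam_valP b)) => -[x01 y01 /andP[z0 z1]]; split=> //; lra.
apply: cvg_trans (cphi _ (sub a)) => B /= HB.
have := @continuous_Lam_val _ p a _ HB.
by apply: (@filterS _ (nbhs a) (nbhs_filter a)) => b; apply.
Qed.

End horseshoe_dynamics.

Theorem theorem2p2 (R : realType) (p : params R)
  (hlambda0 : 0 < lambda0 p < 1 / 3) (hbeta0 : 6 < beta0 p)
  (hlambda1 : 0 < lambda1 p < 1 / 3) (hsigma : 0 < sigma p < 1 / 3)
  (hbeta1 : 3 < beta1 p < 4) :
  (forall phi : R * R * R -> R, {within cube, continuous phi} ->
     exists eta : probability (borel (Lam p)) R,
       equilibrium_state (fun a : Lam p => phi (Lam_val a)) eta) /\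
  (exists G : set (C0 (Lam p) R), residual G /\
     forall phi : C0 (Lam p) R, G phi ->
       unique_equilibrium_state (C0_fun phi)).
Proof.
have l0 : 0 < lambda0 p by case/andP: hlambda0.
have l1 : 0 < lambda1 p by case/andP: hlambda1.
have s0 : 0 < sigma p by case/andP: hsigma.
have b0 : 0 < beta0 p by lra.
have b1 : 0 < beta1 p by lra.
have gen := open_sub_sigma_coordinates (@Lam_open_coord R p).
have mono := FL_monotone l0 b0 l1 s0 b1.
split=> [phi cphi|].
  exact: (equilibrium_exists (@compact_Lam R p) (@continuous_FL R p)
    (@open_lower_piece R p) (@continuous_Lam_coord R p) gen mono
    (@dirac_origin_invariant R p) (continuous_restriction cphi)).
exact: (residual_unique_equilibrium (@compact_Lam R p) (@continuous_FL R p)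
  (@open_lower_piece R p) (@continuous_Lam_coord R p) gen mono
  (@dirac_origin_invariant R p)).
Qed.
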